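(* Let $H$ be an $8$-dimensional linear subspace of $\mathbb{R}^9$ and place spheres of radius $1/\sqrt2$ centered at each point of a copy of the $E_8$ lattice (with minimal vectors of length $\sqrt2$) embedded in $H$. Place two hyperplanes parallel to $H$ at distance $1/\sqrt2$ on either side, so that they are tangent to all the spheres. Let $s_0$ be the sphere centered at the origin of the lattice, let its points of tangency with the two hyperplanes be $A$ and $B$, and let $\sigma$ be inversion in the sphere centered at $A$ and through $B$. Then the image of these spheres and hyperplanes under the group generated by $\sigma$, the symmetries of the $E_8$ lattice, and the reflection in $H$ is a perspective of the sphere packing $\mathcal{P}$ generated by the Coxeter graph which is the tree on eleven nodes $b_0,b_1,\dots,b_{10}$ with simple edges $b_ib_{i+1}$ for $1\le i\le 9$ and $b_0b_3$ (the tree $T_{238}$), where the spheres of $\mathcal{P}$ are the orbit of the weight at $b_{10}$. Moreover, $\mathcal{P}$ is an Apollonian packing (in nine dimensions).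
   Context: The packing $\mathcal{P}$. Let $\mathbb{R}^{1,10}$ be the real vector space with basis $b_0,\dots,b_{10}$ and symmetric bilinear form given by $b_i\cdot b_i=-2$, $b_i\cdot b_j=1$ if $b_ib_j$ is an edge of the graph, and $0$ otherwise for $i\ne j$ (signature $(1,10)$). For $\mathbf n\cdot\mathbf n<0$ put $R_{\mathbf n}(\mathbf x)=\mathbf x-2\frac{\mathbf n\cdot\mathbf x}{\mathbf n\cdot\mathbf n}\mathbf n$. Let $\nu$ be the vector with $\nu\cdot b_{10}=2$, $\nu\cdot b_i=0$ for $i\neq10$ (twice the weight at $b_{10}$; $\nu\cdot\nu=-2$). Then $\mathcal{P}=W(\nu)$ with $W=\langle R_{b_0},\dots,R_{b_{10}}\rangle$. Lorentz space. Let $N=11$. Let $\mathcal{H}$ be the sheet of $\{\mathbf x\cdot\mathbf x=1\}$ containing a positive multiple of the vector $w_0$ with $w_0\cdot b_0=1$, $w_0\cdot b_i=0$ for $i\neq0$; it is a model of $\mathbb{H}^{10}$. Let $\mathcal{L}^+$ be the set of nonzero null vectors with $\mathbf x\cdot w_0>0$ and $\partial\mathcal{H}=\mathcal{L}^+/\mathbb{R}^+$. $\mathcal{O}^+$ is the group of linear maps preserving the form and $\mathcal{H}$; for a lattice $\Lambda$ (the $\mathbb Z$-span of a basis), $\mathcal{O}_\Lambda^+=\{T\in\mathcal{O}^+:T\Lambda=\Lambda\}$. Perspectives. For $E\in\mathcal{L}^+$, $\partial\mathcal{H}_E=\partial\mathcal{H}\setminus\{E\mathbb{R}^+\}$ with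 the metric $|AB|_E^2=\frac{2A\cdot B}{(A\cdot E)(B\cdot E)}$ is isometric to Euclidean $\mathbb{R}^9$. For $\mathbf n\cdot\mathbf n<0$, $H_{\mathbf n,E}=\{\mathbf x\in\partial\mathcal{H}_E:\mathbf n\cdot\mathbf x=0\}$, a hypersphere or hyperplane. A perspective of $\mathcal{P}$ is the configuration $\{H_{\mathbf n,E}:\mathbf n\in\mathcal{P}\}$ in $\partial\mathcal{H}_E\cong\mathbb{R}^9$ for some $E\in\mathcal{L}^+$. Symmetries of the $E_8$ lattice are the isometries of $H$ preserving the lattice (including translations), extended to $\mathbb{R}^9$ by acting trivially orthogonally to $H$; inversions act on $\mathbb{R}^9\cup\{\infty\}$; hyperplanes count as spheres. Apollonian packings. A set $\mathcal{P}\subset\mathbb{R}^{1,N-1}$ is a packing if there is $k>0$ with $\mathbf n\cdot\mathbf n=-k$ for all $\mathbf n\in\mathcal{P}$ and $\mathbf n\cdot\mathbf n'\ge k$ for all distinct $\mathbf n,\mathbf n'\in\mathcal{P}$. It is crystallographic if there are a lattice $\Lambda$, a group $G\le\mathcal{O}_\Lambda^+$ with a convex fundamental domain in $\mathcal{H}$ having finitely many faces, and a finite $S\subset\Lambda$ with $\mathcal{P}=G(S)$ up to positive scaling of vectors. It is maximal if its residual set (the set of points of $\partial\mathcal{H}$ with $\mathbf n\cdot\mathbf x>0$ for all $\mathbf n\in\mathcal{P}$) has empty interior in $\partial\mathcal{H}$. It has the Apollonian property if every element belongs to a set of $N$ elements of $\mathcal{P}$ that are pairwise tangent, i.e. with pairwise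 products $k$. It is Apollonian if it is crystallographic, maximal, and has the Apollonian property. *)

(* Defs.v *)
From HB Require Import structures.
From mathcomp Require Import all_boot all_order all_algebra.
From mathcomp Require Import boolp classical_sets functions cardinality reals topology.
From mathcomp Require Import normedtype.
Set Implicit Arguments.
Unset Strict Implicit.
Unset Printing Implicit Defensive.
Import Order.TTheory GRing.Theory Num.Theory.
Import numFieldNormedType.Exports.
Local Open Scope classical_set_scope.
Local Open Scope ring_scope.

(* R : realType is an arbitrary model of the real numbers. *)

Section TransformationGroups.
Variable T : Type.

(* The group generated by a set S of bijections of T. *)
Inductive generated (S : set (T -> T)) : set (T -> T) :=
| generated_id : generated S id
| generated_in g : S g -> generated S g
| generated_comp g h : generated S g -> generated S h -> generated S (g \o h)
| generated_inv g h :
    generated S g -> cancel g h -> cancel h g -> generated S h.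

Definition transformation_group (G : set (T -> T)) : Prop :=
  [/\ G id,
      forall g h, G g -> G h -> G (g \o h) &
      forall g, G g -> exists2 h, G h & cancel g h /\ cancel h g].

End TransformationGroups.

(* The interior of Y relative to the subspace X. *)
Definition rel_interior (T : topologicalType) (X Y : set T) : set T :=
  [set x | X x /\ \forall y \near x, X y -> Y y].

(* The tree T_{238}: edges b_i b_{i+1} for 1 <= i <= 9, and b_0 b_3. *)
Definition T238_edge (i j : nat) : bool :=
  [|| (0 < i)%N && (j == i.+1), (0 < j)%N && (i == j.+1),
      (i == 0%N) && (j == 3%N) | (i == 3%N) && (j == 0%N)].

Section Lorentz.
Variable R : realType.

(* Vectors of R^{1,10} are represented by their coordinates in b_0..b_10. *)
Local Notation V := 'rV[R]_11.

Definition gram : 'M[R]_11 :=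
  \matrix_(i, j) (if i == j then -2 else if T238_edge i j then 1 else 0).

Definition bform (x y : V) : R := (x *m gram *m y^T) 0 0.
Local Notation "x ⋅ y" := (bform x y) (at level 40).

Definition bvec (i : 'I_11) : V := delta_mx 0 i.

(* The dual basis: weight i ⋅ bvec j is 1 if i = j and 0 otherwise; see
   bform_weight below. *)
Definition weight (i : 'I_11) : V := bvec i *m invmx gram.

Definition w0 : V := weight ord0.
Definition nu : V := 2 *: weight ord_max.

Definition reflection (n x : V) : V := x - (2 * ((n ⋅ x) / (n ⋅ n))) *: n.

Definition weyl_group : set (V -> V) :=
  generated [set reflection (bvec i) | i in [set: 'I_11]].

Definition T238_packing : set V := [set g nu | g in weyl_group].

(* The sheet of x ⋅ x = 1 that contains a positive multiple of w0
   (note that w0 ⋅ w0 = 11/2 > 0). *)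
Definition hyperboloid : set V := [set x | x ⋅ x = 1 /\ 0 < x ⋅ w0].

Definition light_cone : set V := [set x | [/\ x != 0, x ⋅ x = 0 & 0 < x ⋅ w0]].

Definition ray (x : V) : set V := [set c *: x | c in [set c : R | 0 < c]].

Definition boundary : set (set V) := [set ray x | x in light_cone].

(* The quotient topology on light_cone / R^+. *)
Definition boundary_open (U : set (set V)) : Prop :=
  U `<=` boundary /\
  exists2 O : set V, open O &
    [set x | light_cone x /\ U (ray x)] = O `&` light_cone.

Definition is_lattice (L : set V) : Prop :=
  exists2 M : 'M[R]_11, M \in unitmx &
    L = [set map_mx intr z *m M | z in [set: 'rV[int]_11]].

(* The group O^+_L. *)
Definition lattice_isometry (L : set V) (T : V -> V) : Prop :=
  [/\ linear T,
      forall x y, T x ⋅ T y = x ⋅ y,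
      T @` hyperboloid = hyperboloid &
      T @` L = L].

(* A convex subset of the hyperbolic space with finitely many faces: an
   intersection of finitely many closed half-spaces. *)
Definition finite_polyhedron (F : set V) : Prop :=
  exists2 s : seq V, (forall n, n \in s -> n ⋅ n < 0) &
    F = [set x | hyperboloid x /\ forall n, n \in s -> 0 <= n ⋅ x].

Definition fundamental_domain (G : set (V -> V)) (F : set V) : Prop :=
  [/\ F `<=` hyperboloid,
      hyperboloid `<=` [set y | exists2 g, G g & (g @` F) y] &
      forall g h, G g -> G h -> g <> h ->
        (g @` rel_interior hyperboloid F) `&`
        (h @` rel_interior hyperboloid F) = set0].

Definition packing (k : R) (P : set V) : Prop :=
  [/\ 0 < k,
      forall n, P n -> n ⋅ n = - k &
      forall n n', P n -> P n' -> n <> n' -> k <= n ⋅ n'].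

(* Equality up to positive scaling is equality of the sets of rays. *)
Definition crystallographic (P : set V) : Prop :=
  exists (L : set V) (G : set (V -> V)) (S : set V),
  [/\ is_lattice L,
      transformation_group G /\ G `<=` lattice_isometry L,
      exists2 F, finite_polyhedron F & fundamental_domain G F,
      finite_set S /\ S `<=` L &
      [set ray n | n in P] =
      [set r | exists g s, [/\ G g, S s & r = ray (g s)]]].

Definition residual_set (P : set V) : set (set V) :=
  [set ray x | x in [set x | light_cone x /\ forall n, P n -> 0 < n ⋅ x]].

Definition maximal_packing (P : set V) : Prop :=
  forall U, boundary_open U -> U `<=` residual_set P -> U = set0.

Definition apollonian_property (k : R) (P : set V) : Prop :=
  forall n, P n -> exists f : 'I_11 -> V,
    [/\ injective f,
        forall i, P (f i),
        exists i, f i = n &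
        forall i j, i != j -> f i ⋅ f j = k].

Definition apollonian_packing (P : set V) : Prop :=
  exists k, [/\ packing k P, crystallographic P, maximal_packing P &
                apollonian_property k P].

End Lorentz.

Section Euclid.
Variables (R : realType) (d : nat).
Local Notation Ed := 'rV[R]_d.

(* `|x| on row vectors is the sup norm, hence these definitions. *)
Definition eucl_dot (x y : Ed) : R := (x *m y^T) 0 0.
Definition eucl_dist (x y : Ed) : R := Num.sqrt (eucl_dot (x - y) (x - y)).

Definition eucl_sphere (c : Ed) (r : R) : set Ed := [set p | eucl_dist p c = r].

Definition orthogonal_to (H : {vspace Ed}) (v : Ed) : Prop :=
  forall h, h \in H -> eucl_dot h v = 0.

(* The hyperplane (when H has codimension 1) through v parallel to H. *)
Definition parallel (H : {vspace Ed}) (v : Ed) : set Ed :=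
  [set p | p - v \in H].

(* R^d with a point at infinity is option Ed, with None the point at infinity. *)

(* Inversion in the sphere of center c and radius r. *)
Definition inversion (c : Ed) (r : R) (p : option Ed) : option Ed :=
  match p with
  | None => Some c
  | Some q => if q == c then None
              else Some (c + (r ^+ 2 / eucl_dist q c ^+ 2) *: (q - c))
  end.

Definition lattice_symmetry (H : {vspace Ed}) (L : set Ed) (g : Ed -> Ed) :
    Prop :=
  exists f : Ed -> Ed,
  [/\ forall h, h \in H -> f h \in H,
      forall h h', h \in H -> h' \in H -> eucl_dist (f h) (f h') = eucl_dist h h',
      f @` L = L &
      forall h v, h \in H -> orthogonal_to H v -> g (h + v) = f h + v].

Definition reflection_in (H : {vspace Ed}) (g : Ed -> Ed) : Prop :=
  forall h v, h \in H -> orthogonal_to H v -> g (h + v) = h - v.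

End Euclid.

Section E8.
Variable R : realType.
Local Notation E9 := 'rV[R]_9.

(* Its minimal vectors have length sqrt 2. *)
Definition E8_lattice : set 'rV[R]_8 :=
  [set x | ((forall i, x 0 i \is a Num.int) \/
            (forall i, x 0 i - 2^-1 \is a Num.int)) /\
           (\sum_i x 0 i) / 2 \is a Num.int].

Definition linear_isometry (J : 'rV[R]_8 -> E9) : Prop :=
  linear J /\ forall x, eucl_dot (J x) (J x) = eucl_dot x x.

Definition generators (H : {vspace E9}) (L : set E9)
    (sigma : option E9 -> option E9) : set (option E9 -> option E9) :=
  [set sigma] `|` [set omap g | g in lattice_symmetry H L]
              `|` [set omap g | g in reflection_in H].

(* The spheres of radius r centered at the points of L, and the two hyperplanes
   parallel to H through v and - v, completed by the point at infinity. *)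
Definition initial_spheres (H : {vspace E9}) (L : set E9) (r : R) (v : E9) :
    set (set (option E9)) :=
  [set Some @` eucl_sphere c r | c in L] `|`
  [set Some @` parallel H v `|` [set None];
       Some @` parallel H (- v) `|` [set None]].

(* The images of the spheres in C under the elements of G, as subsets of R^9
   (i.e. without the point at infinity). *)
Definition image_spheres (G : set (option E9 -> option E9))
    (C : set (set (option E9))) : set (set E9) :=
  [set Y | exists g X, [/\ G g, C X & Y = [set p | (g @` X) (Some p)]]].

Local Notation V := 'rV[R]_11.

Definition boundary_at (E : V) : set (set V) := @boundary R `\` [set ray E].

(* phi identifies boundary_at E, with the metric |.|_E, with R^9. *)
Definition boundary_chart (E : V) (phi : set V -> E9) : Prop :=
  (forall A B, boundary_at E (ray A) -> boundary_at E (ray B) ->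
     light_cone A -> light_cone B ->
     eucl_dist (phi (ray A)) (phi (ray B)) ^+ 2 =
     2 * bform A B / (bform A E * bform B E)) /\
  phi @` boundary_at E = setT.

(* H_{n,E} *)
Definition boundary_sphere (n E : V) : set (set V) :=
  [set r | boundary_at E r /\
           exists x, [/\ light_cone x, r = ray x & bform n x = 0]].

Definition is_perspective (P : set V) (C : set (set E9)) : Prop :=
  exists2 E, light_cone E &
  exists2 phi, boundary_chart E phi &
    C = [set phi @` boundary_sphere n E | n in P].

End E8.

Section Weights.

(* Twice the inverse of gram. *)
Let inv2 : seq (seq int) :=
 [:: [:: 11; 8; 16; 24; 21; 18; 15; 12; 9; 6; 3];
     [:: 8; 4; 10; 16; 14; 12; 10; 8; 6; 4; 2];
     [:: 16; 10; 20; 32; 28; 24; 20; 16; 12; 8; 4];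
     [:: 24; 16; 32; 48; 42; 36; 30; 24; 18; 12; 6];
     [:: 21; 14; 28; 42; 35; 30; 25; 20; 15; 10; 5];
     [:: 18; 12; 24; 36; 30; 24; 20; 16; 12; 8; 4];
     [:: 15; 10; 20; 30; 25; 20; 15; 12; 9; 6; 3];
     [:: 12; 8; 16; 24; 20; 16; 12; 8; 6; 4; 2];
     [:: 9; 6; 12; 18; 15; 12; 9; 6; 3; 2; 1];
     [:: 6; 4; 8; 12; 10; 8; 6; 4; 2; 0; 0];
     [:: 3; 2; 4; 6; 5; 4; 3; 2; 1; 0; -1]]%Z.

Let gramZ (i j : nat) : int :=
  if i == j then (-2)%Z else if T238_edge i j then 1%Z else 0%Z.

Let inv2Z (i j : nat) : int := nth 0%Z (nth [::] inv2 i) j.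

Let check : bool := all (fun i => all (fun j =>
  foldr (fun k s => intZmod.addz (intRing.mulz (gramZ i k) (inv2Z k j)) s) 0%Z
    (iota 0 11) == (if i == j then 2%Z else 0%Z)) (iota 0 11)) (iota 0 11).

Lemma gram_unit (R : realType) : gram R \in unitmx.
Proof.
have chk : check by vm_compute.
have entry (i j : 'I_11) :
    \sum_(k < 11) gramZ i k * inv2Z k j = (if i == j then 2 else 0) :> int.
  rewrite -(big_mkord xpredT (fun k => gramZ i k * inv2Z k j)).
  have ii (k : 'I_11) : (k : nat) \in iota 0 11 by rewrite mem_iota /=.
  have /eqP := allP (allP chk _ (ii i)) _ (ii j).
  rewrite /index_iota subn0 -(inj_eq val_inj) => <-.
  by rewrite unlock.
have : gram R *m \matrix_(i, j) ((inv2Z i j)%:~R / 2) = 1%:M.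
  apply/matrixP => i j; rewrite !mxE.
  transitivity ((\sum_(k < 11) gramZ i k * inv2Z k j)%:~R / 2 : R).
    rewrite rmorph_sum mulr_suml; apply: eq_bigr => k _; rewrite !mxE rmorphM.
    rewrite /= mulrA; congr (_ * _ / _).
    rewrite /gramZ -(inj_eq val_inj).
    by case: ifP => //=; case: ifP.
  rewrite entry; case: (i == j); last by rewrite mul0r.
  by rewrite divff // pnatr_eq0.
by case/mulmx1_unit.
Qed.

Lemma bform_weight (R : realType) (i j : 'I_11) :
  bform (weight R i) (bvec R j) = (i == j)%:R.
Proof.
rewrite /bform /weight mulmxKV ?gram_unit // /bvec trmx_delta mul_delta_mx_cond.
by rewrite mulmxnE mxE eqxx; case: (i == j).
Qed.

End Weights.

(* Main.v *)
(** In the perspective from the null root delta of the affine diagram b_0, ..., b_8,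
    the reflections in b_0, ..., b_8 act on R^9 as symmetries of the E8 lattice,
    b_9 acts as sigma, b_10 as the reflection in H, and nu becomes the hyperplane
    through A. So W(nu) is contained in the image. Conversely every symmetry of the
    E8 lattice extends to a Lorentz transformation fixing nu and b_10 that permutes
    the roots of affine E8 and sends b_9 into its affine orbit; both kinds of roots
    are W-conjugate to simple ones by descent on height, so it normalises W and
    preserves W(nu).

    Since every w b_i is a nonnegative or nonpositive combination of simple roots,
    the chamber of W is a fundamental domain, and w nu = nu + 2 m with m integral and
    nonnegative, which bounds nu . w nu. For maximality, an integral null vector can
    be moved by W to a dominant one, whose product with nu is at most 0 because the
    inverse Gram matrix has a single negative entry; integral null directions are
    dense. The vector nu and its images under successive reflections in
    b_10, b_9, ..., b_1 are eleven mutually tangent spheres. *)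
Require Import Defs.
From HB Require Import structures.
From mathcomp Require Import all_boot all_order all_algebra.
From mathcomp Require Import boolp classical_sets functions cardinality reals topology.
From mathcomp Require Import normedtype realfun.
From mathcomp Require Import zify ring lra.
Import Order.TTheory GRing.Theory Num.Theory.
Import numFieldNormedType.Exports.
Local Open Scope classical_set_scope.
Local Open Scope ring_scope.

Set Implicit Arguments.
Unset Strict Implicit.
Unset Printing Implicit Defensive.

(** * Coordinates on R^{1,10} *)

Section Coordinates.
Variables (R : realType) (n : nat).
Implicit Types x y : 'rV[R]_n.+1.

(** The form is split orthogonally into a negative definite R^8 ([cu]), a negative line ([cs]) and a
    hyperbolic plane ([ca], [cb]), with [ca x] the product with [delta]. Seen from [delta], [cu] is
    position along H, [cs] is height over the hyperplane through A in units of the normal [v], and a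
    finite point is its null vector with [ca = 1]. In this frame sigma exchanges [ca] and [cb], and
    causal estimates become sums of squares. W is infinite, so each descent needs its own reason to
    stop: coefficient sums for affine roots, a natural-number product for integral null vectors, and
    for real timelike vectors the fact that only finitely many integral images of [rho2] lie below a
    given level. Disjointness of chambers is a separate matter and comes from the length function.
    Symmetries of the lattice are never identified with elements of W. It is enough that the Lorentz
    map of a symmetry carries each simple reflection to a reflection in W and fixes [nu], so the
    automorphism group of E8 need not be determined. *)

Definition crd x (k : nat) : R := x 0 (inord k).
Definition mkrow (f : nat -> R) : 'rV[R]_n.+1 := \row_i f i.

Lemma crdD x y k : crd (x + y) k = crd x k + crd y k. Proof. by rewrite /crd !mxE. Qed.
Lemma crdN x k : crd (- x) k = - crd x k. Proof. by rewrite /crd !mxE. Qed.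
Lemma crdZ c x k : crd (c *: x) k = c * crd x k. Proof. by rewrite /crd !mxE. Qed.
Lemma crd0 k : crd (0 : 'rV[R]_n.+1) k = 0. Proof. by rewrite /crd !mxE. Qed.
Definition crdE := (crdD, crdN, crdZ, crd0).

Lemma crd_ord x (i : 'I_n.+1) : x 0 i = crd x i.
Proof. by rewrite /crd inord_val. Qed.

Lemma crd_mkrow f k : (k < n.+1)%N -> crd (mkrow f) k = f k.
Proof. by move=> ltk; rewrite /crd mxE inordK. Qed.

Lemma crdP x y : (forall k, (k < n.+1)%N -> crd x k = crd y k) -> x = y.
Proof. by move=> e; apply/rowP => i; rewrite !crd_ord e. Qed.

Lemma eucl_dotE x y : eucl_dot x y = \sum_(0 <= i < n.+1) crd x i * crd y i.
Proof.
rewrite big_mkord /eucl_dot mxE; apply: eq_bigr => i _.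
by rewrite !mxE !crd_ord.
Qed.

End Coordinates.
Arguments mkrow {R n} f.
Arguments crd {R n} x k.
Notation "x # k" := (crd x k) (at level 9, k at level 8, format "x # k").

Section Euclidean.
Variables (R : realType) (n : nat).
Local Notation E := 'rV[R]_n.
Implicit Types x y z : E.

Lemma dot_sum x y : eucl_dot x y = \sum_i x 0 i * y 0 i.
Proof. by rewrite /eucl_dot mxE; apply: eq_bigr => i _; rewrite mxE. Qed.

Lemma dotC x y : eucl_dot x y = eucl_dot y x.
Proof. by rewrite !dot_sum; apply: eq_bigr => i _; rewrite mulrC. Qed.

Lemma dotDl x y z : eucl_dot (x + y) z = eucl_dot x z + eucl_dot y z.
Proof. by rewrite /eucl_dot mulmxDl mxE. Qed.
Lemma dotZl c x z : eucl_dot (c *: x) z = c * eucl_dot x z.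
Proof. by rewrite /eucl_dot -scalemxAl mxE. Qed.
Lemma dotNl x z : eucl_dot (- x) z = - eucl_dot x z.
Proof. by rewrite /eucl_dot mulNmx mxE. Qed.
Lemma dotDr x y z : eucl_dot z (x + y) = eucl_dot z x + eucl_dot z y.
Proof. by rewrite dotC dotDl !(dotC _ z). Qed.
Lemma dotZr c x z : eucl_dot z (c *: x) = c * eucl_dot z x.
Proof. by rewrite dotC dotZl (dotC x). Qed.
Lemma dotNr x z : eucl_dot z (- x) = - eucl_dot z x.
Proof. by rewrite dotC dotNl (dotC x). Qed.
Lemma dot0l x : eucl_dot 0 x = 0.
Proof. by rewrite /eucl_dot mul0mx mxE. Qed.
Lemma dot0r x : eucl_dot x 0 = 0.
Proof. by rewrite dotC dot0l. Qed.
Definition dotE := (dotDl, dotDr, dotZl, dotZr, dotNl, dotNr, dot0l, dot0r).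

Lemma dot_ge0 x : 0 <= eucl_dot x x.
Proof. by rewrite dot_sum; apply: sumr_ge0 => i _; rewrite -expr2 sqr_ge0. Qed.

Lemma dot_eq0 x : eucl_dot x x = 0 -> x = 0.
Proof.
rewrite dot_sum => /eqP; rewrite psumr_eq0 => [/allP x0|i _]; last by rewrite -expr2 sqr_ge0.
apply/rowP => i; rewrite mxE; have := x0 i; rewrite mem_index_enum => /(_ isT) /=.
by rewrite mulf_eq0 orbb => /eqP.
Qed.

Lemma eucl_dist_sqr x y : eucl_dist x y ^+ 2 = eucl_dot (x - y) (x - y).
Proof. by rewrite /eucl_dist sqr_sqrtr // dot_ge0. Qed.

Lemma eucl_dist_ge0 x y : 0 <= eucl_dist x y.
Proof. exact: sqrtr_ge0. Qed.

End Euclidean.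

Lemma dot_polarize (R : realType) n m (x y : 'rV[R]_n) (u w : 'rV[R]_m) :
  eucl_dot (x - y) (x - y) = eucl_dot (u - w) (u - w) ->
  eucl_dot x x = eucl_dot u u -> eucl_dot y y = eucl_dot w w ->
  eucl_dot x y = eucl_dot u w.
Proof. by rewrite !dotE (dotC y x) (dotC w u) => e ex ey; rewrite ex ey in e; lra. Qed.

(** * The Lorentz form and a frame adapted to E8 *)

Section Form.
Variable R : realType.
Local Notation V := 'rV[R]_11.
Local Notation "x ⋅ y" := (bform x y) (at level 40).
Implicit Types x y z : V.

Lemma bformE x y : x ⋅ y =
  - 2 * (x#0*y#0 + x#1*y#1 + x#2*y#2 + x#3*y#3 + x#4*y#4 + x#5*y#5 + x#6*y#6
       + x#7*y#7 + x#8*y#8 + x#9*y#9 + x#10*y#10)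
  + (x#0*y#3 + x#3*y#0 + x#1*y#2 + x#2*y#1 + x#2*y#3 + x#3*y#2 + x#3*y#4
   + x#4*y#3 + x#4*y#5 + x#5*y#4 + x#5*y#6 + x#6*y#5 + x#6*y#7 + x#7*y#6
   + x#7*y#8 + x#8*y#7 + x#8*y#9 + x#9*y#8 + x#9*y#10 + x#10*y#9).
Proof.
pose g i j : R := if i == j then -2 else if T238_edge i j then 1 else 0.
have -> : x ⋅ y = \sum_(0 <= j < 11) (\sum_(0 <= i < 11) x#i * g i j) * y#j.
  rewrite big_mkord /bform mxE; apply: eq_bigr => j _.
  rewrite !mxE crd_ord big_mkord; congr (_ * _); apply: eq_bigr => i _.
  by rewrite !mxE crd_ord /g -(inj_eq val_inj).
by rewrite unlock /= /g /=; ring.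
Qed.

Lemma bformC x y : x ⋅ y = y ⋅ x. Proof. by rewrite !bformE; ring. Qed.
Lemma bformDl x y z : (x + y) ⋅ z = x ⋅ z + y ⋅ z.
Proof. by rewrite /bform !mulmxDl mxE. Qed.
Lemma bformZl c x z : (c *: x) ⋅ z = c * (x ⋅ z).
Proof. by rewrite /bform -!scalemxAl mxE. Qed.
Lemma bformNl x z : (- x) ⋅ z = - (x ⋅ z).
Proof. by rewrite /bform !mulNmx mxE. Qed.
Lemma bformDr x y z : z ⋅ (x + y) = z ⋅ x + z ⋅ y.
Proof. by rewrite bformC bformDl !(bformC _ z). Qed.
Lemma bformZr c x z : z ⋅ (c *: x) = c * (z ⋅ x).
Proof. by rewrite bformC bformZl (bformC x). Qed.
Lemma bformNr x z : z ⋅ (- x) = - (z ⋅ x).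
Proof. by rewrite bformC bformNl (bformC x). Qed.
Lemma bform0l x : 0 ⋅ x = 0. Proof. by rewrite /bform !mul0mx mxE. Qed.
Lemma bform0r x : x ⋅ 0 = 0. Proof. by rewrite bformC bform0l. Qed.
Definition bformlE := (bformDl, bformDr, bformZl, bformZr, bformNl, bformNr, bform0l, bform0r).

Lemma bvec_crd i k : (k < 11)%N -> (bvec R i)#k = (k == i)%:R.
Proof. by move=> ltk; rewrite /crd /bvec mxE eqxx /= -(inj_eq val_inj) /= inordK. Qed.

Definition iv (s : seq int) : V := mkrow (fun k => (nth 0%Z s k)%:~R).

(* [cu] sends b_0..b_7 to simple roots of E8 and b_8 to minus the highest root. *)
Definition cu x : 'rV[R]_8 := mkrow (fun k => nth 0
  [:: x#1 / 2 + x#0 - x#2; - x#1 / 2 + x#0 + x#2 - x#3; - x#1 / 2 + x#3 - x#4;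
      - x#1 / 2 + x#4 - x#5; - x#1 / 2 + x#5 - x#6; - x#1 / 2 + x#6 - x#7;
      - x#1 / 2 + x#7 - x#8; x#1 / 2 - x#8] k).
(** The factor makes height count in units of [v], whose squared length is 1/2. Hence the term
    [s ^+ 2 / 2] in squared distances, and [nu ⋅ x = - cs x]. *)
Definition cs x : R := -2 * x#10.
Definition ca x : R := x#9.
Definition cb x : R := x#8 - x#9 + x#10.

Lemma dot8E (u w : 'rV[R]_8) : eucl_dot u w =
  u#0*w#0 + u#1*w#1 + u#2*w#2 + u#3*w#3 + u#4*w#4 + u#5*w#5 + u#6*w#6 + u#7*w#7.
Proof. by rewrite eucl_dotE unlock /=; ring. Qed.

Lemma frameE x y :
  x ⋅ y = - eucl_dot (cu x) (cu y) - cs x * cs y / 2 + ca x * cb y + cb x * ca y.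
Proof. rewrite bformE dot8E /cs /ca /cb /cu !crd_mkrow //=. by field. Qed.

(** Inverse of the frame map by back-substitution: [h] is half of coordinate 1, coordinates 7 down
    to 3 follow along the long arm, and the sum of the first two equations eliminates coordinates 1
    and 2 to give [x0]. *)
Definition mkv (u : 'rV[R]_8) (s a b : R) : V :=
  let x10 := - s / 2 in
  let x8 := b + a - x10 in
  let h := u#7 + x8 in
  let x7 := u#6 + h + x8 in
  let x6 := u#5 + h + x7 in
  let x5 := u#4 + h + x6 in
  let x4 := u#3 + h + x5 in
  let x3 := u#2 + h + x4 in
  let x0 := (u#0 + u#1 + x3) / 2 in
  mkrow (fun k => nth 0 [:: x0; 2 * h; x0 - u#0 + h; x3; x4; x5; x6; x7; x8; a; x10] k).

Lemma mkvK x : mkv (cu x) (cs x) (ca x) (cb x) = x.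
Proof.
apply: crdP => k; rewrite ltnS => lk; rewrite crd_mkrow //.
rewrite /cs /ca /cb /cu !crd_mkrow //=.
by do 11 (case: k lk => [|k] lk /=; first by field).
Qed.

Lemma cu_mkv u s a b : cu (mkv u s a b) = u.
Proof.
apply: crdP => k; rewrite ltnS => lk; rewrite /cu /mkv !crd_mkrow //=.
by do 8 (case: k lk => [|k] lk /=; first by field).
Qed.
Lemma cs_mkv u s a b : cs (mkv u s a b) = s.
Proof. by rewrite /cs /mkv crd_mkrow //=; field. Qed.
Lemma ca_mkv u s a b : ca (mkv u s a b) = a.
Proof. by rewrite /ca /mkv crd_mkrow. Qed.
Lemma cb_mkv u s a b : cb (mkv u s a b) = b.
Proof. by rewrite /cb /mkv !crd_mkrow //=; field. Qed.
Definition mkvE := (cu_mkv, cs_mkv, ca_mkv, cb_mkv).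

Lemma frame_ext x y : cu x = cu y -> cs x = cs y -> ca x = ca y -> cb x = cb y -> x = y.
Proof. by move=> eu es ea eb; rewrite -[x]mkvK eu es ea eb mkvK. Qed.

Lemma cuD x y : cu (x + y) = cu x + cu y.
Proof.
apply: crdP => k; rewrite ltnS => lk; rewrite crdE /cu !crd_mkrow // !crdE.
by do 8 (case: k lk => [|k] lk /=; first by field).
Qed.
Lemma cuZ c x : cu (c *: x) = c *: cu x.
Proof.
apply: crdP => k; rewrite ltnS => lk; rewrite crdE /cu !crd_mkrow // !crdE.
by do 8 (case: k lk => [|k] lk /=; first by field).
Qed.
Lemma csD x y : cs (x + y) = cs x + cs y. Proof. by rewrite /cs crdE; ring. Qed.
Lemma csZ c x : cs (c *: x) = c * cs x. Proof. by rewrite /cs crdE; ring. Qed.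
Lemma caD x y : ca (x + y) = ca x + ca y. Proof. by rewrite /ca crdE; ring. Qed.
Lemma caZ c x : ca (c *: x) = c * ca x. Proof. by rewrite /ca crdE; ring. Qed.
Lemma cbD x y : cb (x + y) = cb x + cb y. Proof. by rewrite /cb !crdE; ring. Qed.
Lemma cbZ c x : cb (c *: x) = c * cb x. Proof. by rewrite /cb !crdE; ring. Qed.
Definition clE := (cuD, cuZ, csD, csZ, caD, caZ, cbD, cbZ).

(** The entries are twice the last row of the inverse Gram matrix. Multiplying by the invertible
    Gram matrix reduces the claim to eleven products with the [bvec j], so no inverse is
    evaluated. *)
Lemma nuE : nu R = iv [:: 3; 2; 4; 6; 5; 4; 3; 2; 1; 0; -1]%Z.
Proof.
apply: (can_inj (mulmxK (gram_unit R))).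
rewrite /nu /weight scalemxAl mulmxKV ?gram_unit //; apply/rowP => j.
transitivity (iv [:: 3; 2; 4; 6; 5; 4; 3; 2; 1; 0; -1]%Z ⋅ bvec R j); last first.
  by rewrite /bform /bvec trmx_delta -colE mxE.
rewrite bformE !bvec_crd // !crd_mkrow //= !mxE eqxx /=.
rewrite -(inj_eq val_inj) /=; case: j => j /= lj.
by do 11 (case: j lj => [|j] lj /=; first by ring).
Qed.

Lemma w0E : w0 R = 2^-1 *: iv [:: 11; 8; 16; 24; 21; 18; 15; 12; 9; 6; 3]%Z.
Proof.
apply: (can_inj (mulmxK (gram_unit R))).
rewrite /w0 /weight mulmxKV ?gram_unit //; apply/rowP => j.
transitivity ((2^-1 *: iv [:: 11; 8; 16; 24; 21; 18; 15; 12; 9; 6; 3]%Z) ⋅ bvec R j); last first.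
  by rewrite /bform /bvec trmx_delta -colE mxE.
rewrite bformE !bvec_crd // !crdE !crd_mkrow //= !mxE eqxx /=.
rewrite -(inj_eq val_inj) /=; case: j => j /= lj.
by do 11 (case: j lj => [|j] lj /=; first by field).
Qed.

End Form.

(** * Words in the simple reflections *)

Section Words.
Variable R : realType.
Local Notation V := 'rV[R]_11.
Local Notation "x ⋅ y" := (bform x y) (at level 40).
Local Notation b := (bvec R).
Local Notation I := 'I_11.
Implicit Types (x y z : V) (v w : seq I) (i j s t : I).

Definition nonneg x : Prop := forall i, 0 <= x 0 i.

Lemma nonnegD x y : nonneg x -> nonneg y -> nonneg (x + y).
Proof. by move=> hx hy i; rewrite mxE addr_ge0. Qed.
Lemma nonnegZ c x : 0 <= c -> nonneg x -> nonneg (c *: x).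
Proof. by move=> hc hx i; rewrite mxE mulr_ge0. Qed.
Lemma nonneg_bvec i : nonneg (b i).
Proof. by move=> j; rewrite mxE ler0n. Qed.
Lemma nonneg0 : nonneg 0.
Proof. by move=> j; rewrite mxE. Qed.

Lemma bform_bvec i j :
  b i ⋅ b j = if i == j then -2 else if T238_edge i j then 1 else 0.
Proof.
rewrite /bform /bvec trmx_delta -rowE -colE !mxE.
by [].
Qed.

Lemma bform_bvec_self i : b i ⋅ b i = -2.
Proof. by rewrite bform_bvec eqxx. Qed.

Lemma row_bvec x : x = \sum_i x 0 i *: b i.
Proof. by rewrite {1}[x]row_sum_delta. Qed.

Lemma bform_suml (F : I -> V) y : (\sum_i F i) ⋅ y = \sum_i (F i ⋅ y).
Proof.
apply: (big_morph (fun x => x ⋅ y)) => [u v|]; last exact: bform0l.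
by rewrite bformDl.
Qed.

Lemma bform_sum x y : x ⋅ y = \sum_i x 0 i * (b i ⋅ y).
Proof.
by rewrite {1}[x]row_bvec bform_suml; apply: eq_bigr => i _; rewrite bformZl.
Qed.

Definition refl i x : V := x + (b i ⋅ x) *: b i.

Lemma reflection_root n x : n ⋅ n = -2 -> reflection n x = x + (n ⋅ x) *: n.
Proof.
by move=> nn; rewrite /reflection nn -scaleNr; congr (_ + _ *: _); field.
Qed.

Lemma reflE i : reflection (b i) = refl i.
Proof. by apply/funext => x; rewrite reflection_root // bform_bvec_self. Qed.

Lemma reflK i : involutive (refl i).
Proof.
move=> x; rewrite /refl !bformlE bform_bvec_self.
by apply/rowP => k; rewrite !mxE; ring.
Qed.

Lemma refl_bform i x y : refl i x ⋅ refl i y = x ⋅ y.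
Proof. by rewrite /refl !bformlE bform_bvec_self (bformC x (b i)); ring. Qed.

Lemma refl_linear i : linear (refl i).
Proof.
move=> c x y; rewrite /refl !bformlE scalerDr !scalerDl -!scalerA.
by rewrite !addrA; congr (_ + _); rewrite -!addrA; congr (_ + _); rewrite addrC.
Qed.

Definition act w x : V := foldr refl x w.

Lemma act_cat v w x : act (v ++ w) x = act v (act w x).
Proof. by rewrite /act foldr_cat. Qed.
Lemma act_rcons w i x : act (rcons w i) x = act w (refl i x).
Proof. by rewrite -cats1 act_cat. Qed.
Lemma act_cons w i x : act (i :: w) x = refl i (act w x).
Proof. by []. Qed.
Lemma act_bform w x y : act w x ⋅ act w y = x ⋅ y.
Proof. by elim: w => //= i w IH; rewrite refl_bform. Qed.
Lemma actD w x y : act w (x + y) = act w x + act w y.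
Proof.
by elim: w => //= i w ->; have := @refl_linear i 1 (act w x) (act w y); rewrite !scale1r.
Qed.
Lemma actZ w c x : act w (c *: x) = c *: act w x.
Proof.
elim: w => //= i w ->; have := @refl_linear i c (act w x) 0.
by rewrite !addr0 {3}/refl bform0r scale0r addr0 addr0.
Qed.
Lemma actK w : cancel (act w) (act (rev w)).
Proof. by elim: w => //= i w IH x; rewrite rev_cons act_rcons reflK IH. Qed.
Lemma actKV w : cancel (act (rev w)) (act w).
Proof. by move=> x; rewrite -{1}[w]revK actK. Qed.
Lemma act_linear w : linear (act w).
Proof. by move=> c x y; rewrite actD actZ. Qed.

Lemma act_adj w x y : act w x ⋅ y = x ⋅ act (rev w) y.
Proof. by rewrite -{1}[y](actKV w) act_bform. Qed.

Lemma weyl_groupP : @weyl_group R = [set act w | w in [set: seq I]].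
Proof.
apply/seteqP; split => g.
  elim => {g} [|g [i _ <-]|g h _ [v _ <-] _ [w _ <-]|g h _ [w _ <-] gh hg].
  - by exists [::].
  - by exists [:: i] => //=; rewrite reflE.
  - by exists (v ++ w) => //; apply/funext => x; rewrite act_cat.
  - by exists (rev w) => //; apply/funext => x; rewrite -{1}[x]hg actK.
case=> w _ <-; elim: w => [|i w IH]; first exact: generated_id.
apply: (@generated_comp _ _ (refl i) (act w)) => //.
by apply: generated_in; exists i => //; rewrite reflE.
Qed.

Lemma packingP n : @T238_packing R n <-> exists w, n = act w (nu R).
Proof.
rewrite /T238_packing weyl_groupP; split.
  by move=> [_ [w _ <-] <-]; exists w.
by move=> [w ->]; exists (act w) => //; exists w.
Qed.

(** * Coxeter length and the sign of roots *)

Definition eqw v w := forall x, act v x = act w x.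

Lemma len_ex w : exists n, `[< exists2 v, eqw v w & size v = n >].
Proof. by exists (size w); apply/asboolP; exists w. Qed.
(** The Coxeter length of [act w]. Words are compared by their action, so no presentation of the
    group enters. *)
Definition len w := ex_minn (len_ex w).

Lemma lenP w : exists2 v, eqw v w & size v = len w.
Proof. by rewrite /len; case: ex_minnP => m /asboolP. Qed.

Lemma len_min v w : eqw v w -> (len w <= size v)%N.
Proof.
move=> vw; rewrite /len; case: ex_minnP => m _; apply.
by apply/asboolP; exists v.
Qed.

Lemma len_eqw v w : eqw v w -> len v = len w.
Proof.
move=> vw; apply/eqP; rewrite eqn_leq; apply/andP; split.
  by have [u uw <-] := lenP w; apply: len_min => x; rewrite uw vw.
by have [u uv <-] := lenP v; apply: len_min => x; rewrite uv vw.
Qed.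

Lemma len_rcons w i : (len (rcons w i) <= (len w).+1)%N.
Proof.
have [v vw <-] := lenP w; rewrite -(size_rcons v i); apply: len_min => x.
by rewrite !act_rcons vw.
Qed.

Lemma len_rconsK w i : (len w <= (len (rcons w i)).+1)%N.
Proof.
rewrite -(@len_eqw (rcons (rcons w i) i) w) ?len_rcons // => x.
by rewrite !act_rcons reflK.
Qed.

Lemma len_split w : eqw [::] w \/
  exists v t, eqw (rcons v t) w /\ len w = (len v).+1.
Proof.
have [v vw] := lenP w; case/lastP: v vw => [|v t] vw; first by left.
rewrite size_rcons => lw; right; exists v, t; split=> //.
apply/eqP; rewrite eqn_leq -{2}lw ltnS len_min // andbT.
by rewrite -(len_eqw vw) len_rcons.
Qed.

Lemma refl_bvec i : refl i (b i) = - b i.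
Proof. by rewrite /refl bform_bvec_self scaleNr scaler_nat mulr2n opprD addNKr. Qed.

Lemma refl_comm s t : b s ⋅ b t = 0 -> eqw [:: s; t] [:: t; s].
Proof.
move=> st x; rewrite /= /refl !bformlE (bformC (b t) (b s)) st.
by apply/rowP => k; rewrite !mxE; ring.
Qed.

Lemma refl_braid s t : b s ⋅ b t = 1 -> eqw [:: s; t; s] [:: t; s; t].
Proof.
move=> st x; rewrite /= /refl !bformlE (bformC (b t) (b s)) st !bform_bvec_self.
by apply/rowP => k; rewrite !mxE; ring.
Qed.

Lemma bvec_cases s t : s <> t -> b s ⋅ b t = 0 \/ b s ⋅ b t = 1.
Proof.
move=> /eqP st; rewrite bform_bvec (negPf st).
by case: ifP; [right|left].
Qed.

(* Tits' argument: the last letter of a reduced word for w commutes with s or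
   braids with it, and in both cases w b_s reduces to shorter words. *)
Lemma tits_nonneg w s : (len w <= len (rcons w s))%N -> nonneg (act w (b s)).
Proof.
have [n] := ubnP (len w); elim: n w s => // n IH w s; rewrite ltnS => lwn hs.
have [w1|[v [t [vw lwv]]]] := len_split w.
  by rewrite -w1; apply: nonneg_bvec.
have lvt : len (rcons v t) = (len v).+1 by rewrite (len_eqw vw).
rewrite -vw act_rcons.
have ws x : act (rcons w s) x = act v (refl t (refl s x)).
  by rewrite act_rcons -vw act_rcons.
have st : s <> t.
  move=> est; move: hs; rewrite (@len_eqw (rcons w s) v) ?lwv ?ltnn // => x.
  by rewrite ws est reflK.
have lvn : (len v < n)%N by rewrite -lwv.
have [st0|st1] := bvec_cases st.
- rewrite /refl bformC st0 scale0r addr0; apply: IH => //.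
  (* As s and t commute, w s = v s t, so a shorter v s would make w s shorter than w. *)
  rewrite leqNgt; apply/negP => lvs.
  have : (len (rcons w s) <= (len (rcons v s)).+1)%N.
    rewrite -(@len_eqw (rcons (rcons v s) t)) ?len_rcons // => x.
    by rewrite ws !act_rcons; congr act; apply: (refl_comm st0).
  by rewrite lwv in hs => /(leq_trans hs); rewrite ltnS leqNgt lvs.
- have -> : refl t (b s) = b s + b t by rewrite /refl bformC st1 scale1r.
  have hvt : nonneg (act v (b t)) by apply: IH => //; rewrite lvt.
  have [lvs|lvs] := leqP (len v) (len (rcons v s)).
    by rewrite actD; apply: nonnegD => //; apply: IH.
  (* Now v = u s with u shorter, and w b_s = u s (b_s + b_t) = u b_t. It remains to see that u t is
     not shorter than u. *)
  set u := rcons v s in lvs.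
  have uv x : act v x = act u (refl s x) by rewrite act_rcons reflK.
  rewrite uv.
  have -> : refl s (b s + b t) = b t.
    by rewrite /refl !bformlE bform_bvec_self st1; apply/rowP => k; rewrite !mxE; ring.
  have lu : len v = (len u).+1.
    by apply/eqP; rewrite eqn_leq lvs len_rconsK.
  apply: IH; first exact: ltn_trans lvs lvn.
  rewrite leqNgt; apply/negP => lut.
  (* The braid relation gives w s = u s t s = u t s t, so a shorter u t would make w s shorter than
     w. *)
  have : (len (rcons w s) <= (len (rcons u t)).+2)%N.
    have e1 := len_rcons (rcons (rcons u t) s) t.
    have e2 := len_rcons (rcons u t) s.
    rewrite (@len_eqw (rcons w s) (rcons (rcons (rcons u t) s) t)).
      by apply: leq_trans e1 _; rewrite ltnS.
    move=> x; rewrite ws 3!act_rcons /u act_rcons; congr (act v _).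
    by have /= -> := refl_braid st1 (refl t x); rewrite reflK.
  by rewrite lwv lu in hs => /(leq_trans hs); rewrite !ltnS leqNgt lut.
Qed.

Lemma descent_split w : ~ eqw [::] w -> exists v t, [/\ eqw (rcons v t) w,
  (len v < len w)%N & nonneg (act v (b t))].
Proof.
move=> w1; have [//|[v [t [vw lwv]]]] := len_split w.
exists v, t; split => //; first by rewrite lwv.
by apply: tits_nonneg; rewrite (len_eqw vw) lwv.
Qed.

Definition dominant x := forall i, 0 <= b i ⋅ x.

(** With w = v t reduced, w x = v x + (b_t ⋅ x) v b_t, and both the scalar and the root are
    nonnegative. *)
Lemma dominant_orbit x w : dominant x -> nonneg (act w x - x).
Proof.
move=> dx; have [n] := ubnP (len w); elim: n w => // n IH w; rewrite ltnS => lwn.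
have [w1|w1] := pselect (eqw [::] w).
  by rewrite -w1 subrr; apply: nonneg0.
have [v [t [vw lv hv]]] := descent_split w1.
rewrite -vw act_rcons /refl actD actZ addrAC.
apply: nonnegD; last exact: nonnegZ.
by apply: IH; apply: leq_trans lwn.
Qed.

Lemma nonneg_anti x : nonneg x -> nonneg (- x) -> x = 0.
Proof.
move=> h1 h2; apply/rowP => i; rewrite mxE; apply/eqP.
by rewrite eq_le h1 andbT -oppr_ge0; have := h2 i; rewrite mxE.
Qed.

Lemma dominant_uniq x w : dominant x -> dominant (act w x) -> act w x = x.
Proof.
move=> dx dwx; apply/eqP; rewrite -subr_eq0; apply/eqP; apply: nonneg_anti.
  exact: dominant_orbit.
by rewrite opprB; have := @dominant_orbit _ (rev w) dwx; rewrite actK.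
Qed.

(** If w = v t is reduced, then w b_t = - v b_t is a nonpositive combination of simple roots, so its
    product with the dominant w x is at most 0, while this product equals b_t ⋅ x > 0. *)
Lemma regular_free x w : (forall i, 0 < b i ⋅ x) -> (forall i, 0 < b i ⋅ act w x) -> eqw [::] w.
Proof.
move=> hx hwx; have [//|w1] := pselect (eqw [::] w); exfalso.
have [v [t [vw lv hv]]] := descent_split w1.
have := hx t; rewrite -(act_bform w) -{1}vw act_rcons refl_bvec.
rewrite -[- b t]scaleN1r actZ bformZl mulN1r ltNge => /negP; apply.
rewrite oppr_le0 bform_sum; apply: sumr_ge0 => i _.
by rewrite mulr_ge0 // ltW.
Qed.

End Words.

(** * Causal structure *)

Section Causal.
Variable R : realType.
Local Notation V := 'rV[R]_11.
Local Notation "x ⋅ y" := (bform x y) (at level 40).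
Local Notation b := (bvec R).
Local Notation I := 'I_11.
Implicit Types (x y z : V) (v w : seq I) (i j s t : I).

(** A reversed Cauchy-Schwarz inequality written as an identity: for causal x and y every term on
    the right is nonnegative. *)
Lemma causalE x y : 2 * (ca x * ca y) * (x ⋅ y) =
  ca x ^+ 2 * (y ⋅ y) + ca y ^+ 2 * (x ⋅ x)
  + eucl_dot (ca x *: cu y - ca y *: cu x) (ca x *: cu y - ca y *: cu x)
  + (ca x * cs y - ca y * cs x) ^+ 2 / 2.
Proof. by rewrite !frameE !dotE (dotC (cu y) (cu x)); field. Qed.

Lemma ca_eq0_le0 x : ca x = 0 -> x ⋅ x <= 0.
Proof.
move=> a0; rewrite frameE a0 mul0r mulr0 !addr0 -expr2.
by have := dot_ge0 (cu x); have := sqr_ge0 (cs x); lra.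
Qed.

Lemma causal_gt0_mul x y : 0 <= x ⋅ x -> 0 < y ⋅ y -> ca x != 0 -> 0 < (ca x * ca y) * (x ⋅ y).
Proof.
move=> hx hy ax.
have : 0 < 2 * (ca x * ca y) * (x ⋅ y).
  rewrite causalE; apply: ltr_wpDr; first by rewrite divr_ge0 ?sqr_ge0.
  apply: ltr_wpDr; first exact: dot_ge0.
  apply: ltr_wpDr; first by rewrite mulr_ge0 ?sqr_ge0.
  by rewrite mulr_gt0 // exprn_even_gt0.
by rewrite -mulrA pmulr_rgt0.
Qed.

Lemma causal_gt0 x y : 0 <= x ⋅ x -> 0 < y ⋅ y -> 0 < ca x -> 0 < ca y -> 0 < x ⋅ y.
Proof.
move=> hx hy ax ay; have := causal_gt0_mul hx hy (lt0r_neq0 ax).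
by rewrite pmulr_rgt0 // mulr_gt0.
Qed.

Lemma causal_ca_gt0 x y : 0 <= x ⋅ x -> 0 < y ⋅ y -> ca x != 0 -> 0 < ca y ->
  0 < x ⋅ y -> 0 < ca x.
Proof.
move=> hx hy ax ay xy; have := causal_gt0_mul hx hy ax.
by rewrite pmulr_lgt0 // pmulr_lgt0.
Qed.

Lemma ca_neq0 x : 0 < x ⋅ x -> ca x != 0.
Proof. by move=> hx; apply/eqP => /ca_eq0_le0; rewrite leNgt hx. Qed.

(* The null root of the affine diagram b_0, ..., b_8; the perspective is taken
   from this point. *)
Definition delta : V := mkv 0 0 0 1.

Lemma bform_delta x : x ⋅ delta = ca x.
Proof. by rewrite frameE !mkvE dot0r; field. Qed.

Lemma w0w0_gt0 : 0 < w0 R ⋅ w0 R.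
Proof. by rewrite w0E bformE !crdE !crd_mkrow //=; lra. Qed.
Lemma ca_w0 : ca (w0 R) = 3.
Proof. by rewrite w0E /ca !crdE !crd_mkrow //=; field. Qed.
Lemma ca_w0_gt0 : 0 < ca (w0 R).
Proof. by rewrite ca_w0. Qed.

(** The sheet is oriented by [w0], but [ca] is easier to follow in the frame. The two orientations
    agree because [w0] is timelike with [ca] equal to 3. *)
Lemma forwardE x : 0 < x ⋅ x -> (0 < x ⋅ w0 R) = (0 < ca x).
Proof.
move=> hx; have h0 := w0w0_gt0; have a0 := ca_w0_gt0; apply/idP/idP.
  by apply: causal_ca_gt0 => //; [exact: ltW|exact: ca_neq0].
by move=> ax; apply: causal_gt0 => //; exact: ltW.
Qed.

Lemma hyperboloidP x : hyperboloid x <-> x ⋅ x = 1 /\ 0 < ca x.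
Proof.
by split=> -[x1 hx]; split=> //; move: hx; rewrite forwardE ?x1 ?ltr01.
Qed.

Lemma null_ca0 x : x ⋅ x = 0 -> ca x = 0 -> x = cb x *: delta.
Proof.
rewrite frameE => hx a0; rewrite a0 mul0r mulr0 !addr0 in hx.
have h1 := dot_ge0 (cu x); have h2 := sqr_ge0 (cs x).
have u0 : cu x = 0 by apply: dot_eq0; lra.
have /eqP s0 : cs x ^+ 2 == 0 by rewrite expr2; apply/eqP; lra.
have {}s0 : cs x = 0 by apply/eqP; rewrite -sqrf_eq0 s0.
by apply: frame_ext; rewrite !clE ?mkvE ?u0 ?s0 ?a0 ?scaler0 ?mulr0 ?mulr1.
Qed.

(** The only forward null direction on which [ca] vanishes is that of [delta], the point at infinity
    of the perspective. *)
Lemma light_coneP x : light_cone x <->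
  x ⋅ x = 0 /\ (0 < ca x \/ exists2 c, 0 < c & x = c *: delta).
Proof.
have h0 := w0w0_gt0; have a0 := ca_w0_gt0; split.
  case=> x0 xx hx; split=> //.
  have [ax|ax] := eqVneq (ca x) 0; last first.
    by left; apply: (causal_ca_gt0 _ h0) => //; rewrite xx.
  right; exists (cb x); last exact: null_ca0.
  move: hx; rewrite [x in x ⋅ _](null_ca0 xx ax) bformZl bformC bform_delta.
  by rewrite pmulr_lgt0.
case=> xx [ax|[c c0 ->]].
  split=> //; last by apply: causal_gt0 => //; rewrite xx.
  by apply: contraTneq ax => ->; rewrite /ca crd0 ltxx.
have dw : delta ⋅ w0 R = ca (w0 R) by rewrite bformC bform_delta.
split.
- rewrite scaler_eq0 negb_or lt0r_neq0 //=; apply/eqP => d0.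
  by move: a0; rewrite -dw d0 bform0l ltxx.
- by rewrite bformZl bformZr bform_delta /ca /delta -/(ca _) ca_mkv !mulr0.
- by rewrite bformZl dw mulr_gt0.
Qed.

Lemma light_delta : light_cone delta.
Proof.
apply/light_coneP; split; first by rewrite bform_delta ca_mkv.
by right; exists 1; rewrite ?scale1r.
Qed.

Lemma ca_bvec i : i != 9%N :> nat -> ca (b i) = 0.
Proof. by move=> hi; rewrite /ca bvec_crd // eq_sym (negPf hi). Qed.

Lemma bvec_w0 i : i != 0%N :> nat -> b i ⋅ w0 R = 0.
Proof.
by move=> hi; rewrite bformC /w0 bform_weight -(inj_eq val_inj) /= eq_sym (negPf hi).
Qed.

(** Each simple reflection preserves one of two functionals that detect the sheet: [ca] for i = 0,
    and the product with [w0] for all other i. *)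
Lemma refl_forward i x : 0 < x ⋅ x -> 0 < ca x -> 0 < ca (refl i x).
Proof.
move=> hx ax; have [i0|i0] := eqVneq (i : nat) 0%N.
  by rewrite /refl !clE ca_bvec ?i0 // mulr0 addr0.
rewrite -forwardE ?refl_bform // /refl bformDl bformZl bvec_w0 // mulr0 addr0.
by rewrite forwardE.
Qed.

Lemma act_forward w x : 0 < x ⋅ x -> 0 < ca x -> 0 < ca (act w x).
Proof.
by move=> hx ax; elim: w => //= i w IH; apply: refl_forward; rewrite ?act_bform.
Qed.

Lemma act_hyperboloid w x : hyperboloid x -> hyperboloid (act w x).
Proof.
move=> /hyperboloidP[x1 ax]; apply/hyperboloidP; rewrite act_bform; split=> //.
by apply: act_forward; rewrite ?x1.
Qed.

(** * Integral vectors and the Weyl vector *)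

Definition integral x : Prop := forall i, x 0 i \is a Num.int.

Lemma integral_crd x k : integral x -> x#k \is a Num.int. Proof. by apply. Qed.
Lemma integralD x y : integral x -> integral y -> integral (x + y).
Proof. by move=> hx hy i; rewrite mxE rpredD. Qed.
Lemma integralZ c x : c \is a Num.int -> integral x -> integral (c *: x).
Proof. by move=> hc hx i; rewrite mxE rpredM. Qed.
Lemma integral_bvec i : integral (b i).
Proof. by move=> j; rewrite mxE rpred_nat. Qed.
Lemma integral_iv l : integral (iv R l).
Proof. by move=> j; rewrite mxE. Qed.

Lemma integral_bform x y : integral x -> integral y -> x ⋅ y \is a Num.int.
Proof.
move=> hx hy; rewrite bform_sum; apply: rpred_sum => i _; apply: rpredM => //.
rewrite bformC bform_sum; apply: rpred_sum => j _; apply: rpredM => //.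
rewrite bform_bvec; case: ifP => _; first by rewrite rpredN rpred_nat.
by case: ifP => _; rewrite ?rpred1 ?rpred0.
Qed.

Lemma integral_refl i x : integral x -> integral (refl i x).
Proof.
move=> hx; apply: integralD => //; apply: integralZ (integral_bvec i).
exact: integral_bform (integral_bvec i) hx.
Qed.

Lemma integral_act w x : integral x -> integral (act w x).
Proof. by move=> hx; elim: w => //= i w; apply: integral_refl. Qed.

Lemma integral_nu : integral (nu R).
Proof. by rewrite nuE; apply: integral_iv. Qed.

(* Twice the Weyl vector. *)
Definition rho2 : V :=
  iv R [:: 143; 94; 190; 288; 245; 204; 165; 128; 93; 60; 29]%Z.

Lemma rho2_bvec i : b i ⋅ rho2 = 2.
Proof.
rewrite bformE !bvec_crd // !crd_mkrow //=; case: i => j lj /=.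
by do 11 (case: j lj => [|j] lj /=; first by ring).
Qed.
Lemma rho2_gt0 : 0 < rho2 ⋅ rho2.
Proof. by rewrite bformE !crd_mkrow //=; lra. Qed.
Lemma ca_rho2 : 0 < ca rho2.
Proof. by rewrite /ca crd_mkrow //=; lra. Qed.

End Causal.

(** * Tiling and crystallographic structure *)

Section Tiling.
Variable R : realType.
Local Notation V := 'rV[R]_11.
Local Notation "x ⋅ y" := (bform x y) (at level 40).
Local Notation b := (bvec R).
Local Notation I := 'I_11.
Implicit Types (x y z : V) (v w : seq I) (i j s t : I).

Lemma bform_weightr x j : x ⋅ weight R j = x 0 j.
Proof.
rewrite bform_sum (bigD1 j) //= bformC bform_weight eqxx mulr1 big1 ?addr0 // => i ij.
by rewrite bformC bform_weight eq_sym (negPf ij) mulr0.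
Qed.

Lemma quadratic_small (p q r : R) : 0 < p ->
  exists2 e0, 0 < e0 & forall e, 0 <= e -> e <= e0 ->
    0 < p + e * q + e ^+ 2 * r.
Proof.
move=> p0; pose m := `|q| + `|r| + p.
have q0 := normr_ge0 q; have r0 := normr_ge0 r.
have m0 : 0 < m by rewrite /m; lra.
exists (p / (2 * m)); first by rewrite divr_gt0 // mulr_gt0.
move=> e e0; rewrite ler_pdivlMr ?mulr_gt0 // => em.
have e1 : e <= 1.
  have : e * (2 * m) <= 1 * m by apply: le_trans em _; rewrite mul1r /m; lra.
  by move=> h; nra.
have q1 : - `|q| <= q by rewrite lerNl -normrN ler_norm.
have r1 : - `|r| <= r by rewrite lerNl -normrN ler_norm.
have h1 := ler_wpM2l e0 q1.
have h2 := ler_wpM2l (sqr_ge0 e) r1.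
have h3 : e ^+ 2 * `|r| <= e * `|r|.
  by rewrite ler_wpM2r // expr2 -{3}[e]mulr1 ler_wpM2l.
have h4 : e * (2 * m) = 2 * (e * `|q|) + 2 * (e * `|r|) + 2 * (e * p) by rewrite /m; ring.
have ep : 0 <= e * p by rewrite mulr_ge0 // ltW.
rewrite h4 in em; rewrite mulrN in h1; rewrite mulrN in h2; lra.
Qed.

Lemma forward_perturb x y : 0 < x ⋅ x -> 0 < ca x ->
  exists2 e0, 0 < e0 & forall e, 0 <= e -> e <= e0 ->
    0 < (x + e *: y) ⋅ (x + e *: y) /\ 0 < ca (x + e *: y).
Proof.
move=> hx ax.
have [e1 e1p he1] := quadratic_small (2 * (x ⋅ y)) (y ⋅ y) hx.
have [e2 e2p he2] := quadratic_small (ca y) 0 ax.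
exists (Num.min e1 e2); first by rewrite lt_min e1p.
move=> e e0; rewrite le_min => /andP[l1 l2]; split.
  rewrite !bformlE (bformC y x) (_ : _ + _ = x ⋅ x + e * (2 * (x ⋅ y)) + e ^+ 2 * (y ⋅ y)).
    exact: he1.
  by ring.
by have := he2 e e0 l2; rewrite mulr0 addr0 !clE.
Qed.

(* x +- e weight_j is still timelike and forward for small e, so it has positive
   product with y. *)
Lemma coordinate_bound x j : 0 < x ⋅ x -> 0 < ca x ->
  exists2 K : R, 0 < K & forall y, 0 < y ⋅ y -> 0 < ca y -> `|y 0 j| <= K * (x ⋅ y).
Proof.
move=> hx ax.
have [e1 e1p he1] := forward_perturb (weight R j) hx ax.
have [e2 e2p he2] := forward_perturb (- weight R j) hx ax.
pose e := Num.min e1 e2.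
have ep : 0 < e by rewrite lt_min e1p.
exists e^-1; first by rewrite invr_gt0.
move=> y hy ay; rewrite mulrC ler_pdivlMr //.
have l1 : e <= e1 by rewrite ge_min lexx.
have l2 : e <= e2 by rewrite ge_min lexx orbT.
have [h1 a1] := he1 e (ltW ep) l1.
have [h2 a2] := he2 e (ltW ep) l2.
have := causal_gt0 (ltW h1) hy a1 ay.
have := causal_gt0 (ltW h2) hy a2 ay.
rewrite !bformlE (bformC (weight R j) y) bform_weightr => p2 p1.
by case: (ger0P (y 0 j)) => _; lra.
Qed.

Lemma int_box (z : int) (N : nat) : `|z%:~R| <= N%:R :> R ->
  exists k : 'I_(2 * N).+1, k%:R - N%:R = z%:~R :> R.
Proof.
rewrite -[N%:R]/(N%:Z%:~R) -intr_norm ler_int => zN.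
have kN : (absz (z + N%:Z)%R < (2 * N).+1)%N by lia.
exists (Ordinal kN) => /=.
by rewrite -[(absz _)%:R]/((absz _)%:Z%:~R) -intrB; congr (_%:~R); lia.
Qed.

(** Moving w to the other factor, x is paired with the images of [rho2], which are integral,
    timelike and forward. Those whose product with x is at most the initial value C have bounded
    coordinates, so they lie in a finite box of integer vectors, where a minimum exists. *)
Lemma orbit_min x : 0 < x ⋅ x -> 0 < ca x -> exists w, forall v,
  act w x ⋅ rho2 R <= act v x ⋅ rho2 R.
Proof.
move=> hx ax; pose m w := act (rev w) (rho2 R).
have mE w : act w x ⋅ rho2 R = x ⋅ m w by rewrite act_adj.
have /choice[K hK] : forall j, exists K : R, 0 < K /\
    forall y, 0 < y ⋅ y -> 0 < ca y -> `|y 0 j| <= K * (x ⋅ y).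
  by move=> j; have [K K0 hK] := coordinate_bound j hx ax; exists K.
pose C := x ⋅ rho2 R.
have C0 : 0 <= C.
  by apply/ltW/causal_gt0 => //; [exact: ltW|exact: rho2_gt0|exact: ca_rho2].
pose N := Num.bound (C * \sum_j K j).
have hN w j : x ⋅ m w <= C -> `|m w 0 j| <= N%:R.
  move=> hC; apply: ltW; apply: le_lt_trans (archi_boundP _); last first.
    by rewrite mulr_ge0 // sumr_ge0 // => i _; rewrite ltW // (hK i).1.
  apply: le_trans ((hK j).2 (m w) _ _) _.
  - by rewrite act_bform rho2_gt0.
  - by apply: act_forward; [exact: rho2_gt0|exact: ca_rho2].
  rewrite mulrC; apply: ler_pM => //.
  - by apply/ltW/causal_gt0 => //; rewrite ?act_bform ?rho2_gt0 ?act_forward ?rho2_gt0 ?ca_rho2 ?ltW.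
  - by rewrite ltW // (hK j).1.
  - rewrite (bigD1 j) //= lerDl; apply: sumr_ge0 => i _.
    by rewrite ltW // (hK i).1.
pose vec (t : {ffun I -> 'I_(2 * N).+1}) : V := \row_j ((t j)%:R - N%:R).
pose P u := `[< exists w, m w = vec u >].
have box w : x ⋅ m w <= C -> exists u, vec u = m w.
  move=> hC; have /choice[u hu] : forall j, exists k : 'I_(2 * N).+1,
      k%:R - N%:R = m w 0 j.
    move=> j; have /floorK mK : m w 0 j \is a Num.int.
      by apply: integral_act; apply: integral_iv.
    have := hN w j hC; rewrite -mK => /int_box[k <-].
    by exists k.
  by exists [ffun j => u j]; apply/rowP => j; rewrite mxE ffunE hu.
have hC0 : x ⋅ m [::] <= C by [].
have [t0 ht0] := box [::] hC0.
have P0 : P t0 by apply/asboolP; exists [::].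
case: (arg_minP (fun u => x ⋅ vec u) P0) => t1 /asboolP[w wt] tmin.
exists w => v; rewrite !mE.
(* Images outside the box exceed C, the value of the empty word, which the minimum does not. *)
have [hv|hv] := leP (x ⋅ m v) C; last first.
  by apply: le_trans (ltW hv); rewrite wt; apply: le_trans (tmin t0 P0) _; rewrite ht0.
have [s hs] := box v hv; rewrite wt -hs; apply: tmin.
by apply/asboolP; exists v.
Qed.

(** Reflecting in b_i changes the product with [rho2] by 2 (b_i ⋅ x), which cannot be negative at a
    minimum. *)
Lemma tiling x : 0 < x ⋅ x -> 0 < ca x -> exists w, dominant (act w x).
Proof.
move=> hx ax; have [w wmin] := orbit_min hx ax; exists w => i.
have := wmin (i :: w); rewrite /= /refl bformDl bformZl rho2_bvec.
by rewrite lerDl pmulr_lge0.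
Qed.

End Tiling.

(** * The chamber as fundamental domain *)

Section Crystallographic.
Variable R : realType.
Local Notation V := 'rV[R]_11.
Local Notation "x ⋅ y" := (bform x y) (at level 40).
Local Notation b := (bvec R).
Local Notation I := 'I_11.
Implicit Types (x y z : V) (v w : seq I) (i j s t : I).

Definition chamber : set V :=
  [set x | hyperboloid x /\ forall n, n \in [seq b i | i <- enum I] -> 0 <= n ⋅ x].

Lemma chamberP x : chamber x <-> hyperboloid x /\ dominant x.
Proof.
split=> -[hx dx]; split=> //.
  by move=> i; apply: dx; apply: map_f; rewrite mem_enum.
by move=> n /mapP[i _ ->]; exact: dx.
Qed.

(** If x lay on the wall of b_i, the curve [y] would stay on the hyperboloid and leave the chamber
    at once, since b_i ⋅ [y t] = -2 t. *)
Lemma rel_interior_chamber x i : rel_interior (@hyperboloid R) chamber x -> 0 < b i ⋅ x.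
Proof.
move=> [hx nx].
have /chamberP[_ dx] : chamber x by apply: (nbhs_singleton nx).
rewrite lt_def dx andbT; apply/eqP => bx0.
pose y (t : R) : V := Num.sqrt (1 + 2 * t ^+ 2) *: x + t *: b i.
have y0 : y 0 = x by rewrite /y expr0n mulr0 addr0 sqrtr1 scale1r scale0r addr0.
have cy : y t @[t --> (0 : R)] --> x.
  rewrite -[X in _ --> X]y0; apply: cvgD; last by apply: cvgZr_tmp; exact: cvg_id.
  apply: cvgZr_tmp; apply: (@continuous_comp _ _ _ (fun t : R => 1 + 2 * t ^+ 2) Num.sqrt).
    apply: cvgD; first exact: cvg_cst.
    by apply: cvgM; [exact: cvg_cst|apply: cvgM; exact: cvg_id].
  exact: sqrt_continuous.
have /nbhs_ballP[e /= e0 he] := cy _ nx.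
have /he/= hy : ball (0 : R) e (e / 2).
  by rewrite /ball /= sub0r normrN gtr0_norm ?divr_gt0 // ltr_pdivrMr // ltr_pMr // ltr1n.
have [x1 w1] := hx; set t := e / 2 in hy.
have t0 : 0 < t by rewrite divr_gt0.
have s0 : 0 < 1 + 2 * t ^+ 2 by rewrite ltr_wpDr // mulr_ge0 // sqr_ge0.
have /hy/chamberP[_ /(_ i)] : hyperboloid (y t).
  split; rewrite /y !bformlE.
    rewrite (bformC x (b i)) bx0 bform_bvec_self x1 !mulr0 mulr1 addr0 add0r.
    by rewrite -expr2 sqr_sqrtr ?ltW //; ring.
  apply: ltr_wpDr; last by rewrite mulr_gt0 // sqrtr_gt0.
  apply: mulr_ge0; first exact: ltW.
  by rewrite bformC /w0 bform_weight ler0n.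
by rewrite /y !bformlE bx0 bform_bvec_self mulr0 add0r => h; lra.
Qed.

Lemma fundamental_chamber : fundamental_domain (@weyl_group R) chamber.
Proof.
split=> [x []//|x hx|g h].
  have /hyperboloidP[x1 ax] := hx.
  have [w dw] : exists w, dominant (act w x) by apply: tiling; rewrite ?x1.
  exists (act (rev w)); first by rewrite weyl_groupP; exists (rev w).
  exists (act w x); last exact: actK.
  by apply/chamberP; split=> //; apply: act_hyperboloid.
rewrite weyl_groupP => -[v _ <-] [w _ <-] vw; rewrite -subset0 => x [[y hy yx] [z hz zx]].
apply: vw; apply/funext => u.
(* A common interior point makes this word send one strictly dominant vector to another, so it acts
   trivially. *)
have e : act (rev w ++ v) y = z by rewrite act_cat yx -zx actK.
have f : eqw R [::] (rev w ++ v).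
  apply: (@regular_free _ y) => i; first exact: rel_interior_chamber.
  by rewrite e; apply: rel_interior_chamber.
by have := f u; rewrite /= act_cat => {2}->; rewrite actKV.
Qed.

Definition root_lattice : set V := [set x | integral x].

Lemma root_lattice_is_lattice : is_lattice root_lattice.
Proof.
exists 1%:M; first exact: unitmx1.
apply/seteqP; split => [x ix|_ [z _ <-] i]; last first.
  by rewrite mulmx1 mxE.
exists (map_mx Num.floor x) => //; rewrite mulmx1; apply/rowP => i.
by rewrite !mxE floorK.
Qed.

Lemma act_lattice_isometry w : lattice_isometry root_lattice (act w).
Proof.
have H (A : set V) : (forall u x, A x -> A (act u x)) -> act w @` A = A.
  move=> hA; apply/seteqP; split=> [_ [x Ax <-]|x Ax]; first exact: hA.
  by exists (act (rev w) x); [exact: hA|exact: actKV].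
split; [exact: act_linear|exact: act_bform| |]; apply: H => u x.
  exact: act_hyperboloid.
exact: integral_act.
Qed.

Lemma weyl_transformation_group : transformation_group (@weyl_group R).
Proof.
split; first exact: generated_id.
  by move=> g h; apply: generated_comp.
rewrite weyl_groupP => _ [w _ <-]; exists (act (rev w)).
  by exists (rev w).
by split; [exact: actK|exact: actKV].
Qed.

Lemma T238_crystallographic : crystallographic (@T238_packing R).
Proof.
exists root_lattice, (@weyl_group R), [set nu R]; split.
- exact: root_lattice_is_lattice.
- split; first exact: weyl_transformation_group.
  by rewrite weyl_groupP => _ [w _ <-]; apply: act_lattice_isometry.
- exists chamber; last exact: fundamental_chamber.
  exists [seq b i | i <- enum I] => // n /mapP[i _ ->].
  by rewrite bform_bvec_self oppr_lt0 ltr0n.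
- by split; [exact: finite_set1|move=> _ ->; exact: integral_nu].
- apply/seteqP; split=> [_ [_ [g Gg <-] <-]|_ [g [s [Gg -> ->]]]].
    by exists g, (nu R).
  by exists (g (nu R)) => //; exists g.
Qed.

End Crystallographic.

(** * Packing and Apollonian properties *)

Section Packing.
Variable R : realType.
Local Notation V := 'rV[R]_11.
Local Notation "x ⋅ y" := (bform x y) (at level 40).
Local Notation b := (bvec R).
Local Notation I := 'I_11.
Local Notation nu := (nu R).
Implicit Types (x y z : V) (v w : seq I) (i j s t : I).

Lemma bform_nu x : nu ⋅ x = 2 * x#10.
Proof. by rewrite nuE bformE !crd_mkrow //=; ring. Qed.

Lemma bvec_nu i : b i ⋅ nu = if i == 10%N :> nat then 2 else 0.
Proof.
rewrite bformC bform_nu bvec_crd // eq_sym.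
by case: ifP => _; rewrite ?mulr1 ?mulr0.
Qed.

Lemma nu_dominant : dominant nu.
Proof. by move=> i; rewrite bvec_nu; case: ifP. Qed.

Lemma nu_nu : nu ⋅ nu = -2.
Proof. by rewrite bform_nu nuE crd_mkrow //=; ring. Qed.

(** All products b_i ⋅ nu are even, so W acts trivially on the class of nu modulo twice the root
    lattice. *)
Lemma act_nu_even w : exists2 m, integral m & act w nu = nu + 2 *: m.
Proof.
elim: w => [|i w [m im IH]].
  by exists 0; rewrite ?scaler0 ?addr0 // => j; rewrite mxE rpred0.
have [c ic ec] : exists2 c : R, c \is a Num.int & b i ⋅ nu = 2 * c.
  by rewrite bvec_nu; case: ifP => _; [exists 1|exists 0]; rewrite ?rpred1 ?rpred0 ?mulr1 ?mulr0.
exists (m + (c + b i ⋅ m) *: b i).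
  apply: integralD => //; apply: integralZ (integral_bvec R i).
  by rewrite rpredD // integral_bform //; exact: integral_bvec.
rewrite act_cons IH /refl bformDr ec bformZr.
by apply/rowP => k; rewrite !mxE; ring.
Qed.

Lemma sum_coord_bvec x c i : \sum_j (x + c *: b i) 0 j = \sum_j x 0 j + c.
Proof.
under eq_bigr => j _ do rewrite mxE; rewrite big_split /=; congr (_ + _).
rewrite (bigD1 i) //= big1 => [|j ji]; first by rewrite !mxE !eqxx mulr1 addr0.
by rewrite !mxE (negPf ji) mulr0.
Qed.

(** Induction on the coefficient sum of w nu - nu, a nonnegative integral vector. If w nu is not
    dominant, some reflection lowers the sum; at level 0 it is not that of b_10, so it fixes nu and
    the induction applies. *)
Lemma act_nu_level0 w : (act w nu - nu)#10 = 0 -> act w nu = nu.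
Proof.
have gint u j : (act u nu - nu) 0 j \is a Num.int.
  move: j; rewrite -scaleN1r; apply: integralD; first exact/integral_act/integral_nu.
  by apply: integralZ (@integral_nu R); rewrite rpredN rpred1.
have gpos u : nonneg (act u nu - nu) by apply: dominant_orbit nu_dominant.
have [n] : exists n, \sum_j (act w nu - nu) 0 j < n%:R.
  exists (Num.bound (\sum_j (act w nu - nu) 0 j)); apply: archi_boundP.
  by apply: sumr_ge0 => j _; apply: gpos.
elim: n w => [|n IH] w hn g0.
  by move: hn; rewrite ltNge sumr_ge0 // => j _; apply: gpos.
have [dw|/existsNP[i /negP]] := pselect (dominant (act w nu)).
  exact: dominant_uniq nu_dominant dw.
rewrite -ltNge => hi; pose c := b i ⋅ act w nu.
have c1 : c <= -1.
  have /intrP[m cm] : c \is a Num.int.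
    by apply: integral_bform (integral_bvec R i) _; apply: integral_act; exact: integral_nu.
  rewrite -/c cm in hi *; rewrite -[-1]/((-1)%:~R) ler_int.
  by rewrite -[0]/(0%:~R) ltr_int in hi; lia.
(* At level 0 the product of b_10 with w nu is 2 plus a nonnegative coordinate. *)
have i10 : i != 10%N :> nat.
  apply/eqP => ei; move: hi; rewrite ltNge => /negP; apply.
  have -> : act w nu = nu + (act w nu - nu) by rewrite addrC subrK.
  rewrite bformDr bvec_nu ei eqxx.
  have -> : b i ⋅ (act w nu - nu) = (act w nu - nu)#9 - 2 * (act w nu - nu)#10.
    by rewrite bformE !bvec_crd // !ei /=; ring.
  by rewrite g0 mulr0 subr0 addr_ge0 //; apply: gpos.
have e : act (i :: w) nu - nu = (act w nu - nu) + c *: b i.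
  by rewrite act_cons /refl addrAC.
have fixnu : refl i nu = nu by rewrite /refl bvec_nu (negPf i10) scale0r addr0.
have : act (i :: w) nu = nu.
  apply: IH; rewrite e; last by rewrite crdD crdZ g0 bvec_crd // eq_sym (negPf i10) mulr0 addr0.
  by rewrite sum_coord_bvec; move: hn; rewrite -natr1; lra.
by rewrite act_cons => h; rewrite -[LHS](reflK i) h fixnu.
Qed.

(** For w nu = nu + 2 m the product is -2 + 4 m_10, and m_10 is a nonnegative integer that vanishes
    only if w nu = nu. *)
Lemma nu_orbit_gap w : act w nu <> nu -> 2 <= nu ⋅ act w nu.
Proof.
move=> wn; have [m im e] := act_nu_even w.
have g := dominant_orbit w nu_dominant.
rewrite e bformDr bformZr nu_nu bform_nu.
have m10 : 0 <= m#10.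
  have := g (inord 10); rewrite e addrAC subrr add0r mxE pmulr_rge0 //.
have m0 : m#10 != 0.
  apply/eqP => m0; apply: wn; apply: act_nu_level0.
  by rewrite e addrAC subrr add0r crdZ m0 mulr0.
have [k mk] : exists k : int, m#10 = k%:~R by apply/intrP; apply: im.
have : 1 <= m#10.
  move: m10 m0; rewrite mk ler0z intr_eq0 => k0 k1.
  by rewrite -[1]/(1%:~R) ler_int; lia.
lra.
Qed.

Lemma T238_is_packing : packing 2 (@T238_packing R).
Proof.
split=> // [n /packingP[w ->]|n n' /packingP[v ->] /packingP[w ->] vw].
  by rewrite act_bform nu_nu.
rewrite act_adj -act_cat; apply: nu_orbit_gap => e; apply: vw.
by rewrite -{1}e act_cat actKV.
Qed.

(* nu and its successive images under the reflections in b_10, b_9, ..., b_1. *)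
Definition simplex (k : nat) : V :=
  mkrow (fun m => (nth 0%Z [:: 3; 2; 4; 6; 5; 4; 3; 2; 1; 0; -1]%Z m)%:~R
                  + 2 * (10 - k < m)%N%:R).

Lemma simplex0 : simplex 0 = nu.
Proof.
apply: crdP => m lm; rewrite nuE !crd_mkrow // subn0.
by rewrite ltnNge -ltnS lm mulr0 addr0.
Qed.

Lemma simplexS k : (k < 10)%N -> simplex k.+1 = refl (inord (10 - k)) (simplex k).
Proof.
move=> lk; have l10 : (10 - k < 11)%N by lia.
have e : b (inord (10 - k)) ⋅ simplex k = 2.
  rewrite bformE !bvec_crd // !crd_mkrow // inordK //.
  by do 10 (case: k lk l10 => [|k] lk l10; first by rewrite /=; ring).
rewrite /refl e; apply: crdP => m lm; rewrite crdD crdZ bvec_crd // !crd_mkrow //.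
rewrite inordK // -addrA -mulrDr -natrD; congr (_ + _ * _%:R).
by case: eqP; case: ltnP; case: ltnP; lia.
Qed.

Lemma simplex_packing k : (k < 11)%N -> @T238_packing R (simplex k).
Proof.
elim: k => [|k IH] lk; apply/packingP.
  by exists [::]; rewrite simplex0.
have /packingP[w e] := IH (ltnW lk).
by exists (inord (10 - k) :: w); rewrite simplexS // e.
Qed.

Lemma simplex_tangent k l : (k < l < 11)%N -> simplex k ⋅ simplex l = 2.
Proof.
move=> /andP[kl ll]; rewrite bformE !crd_mkrow //.
do 11 (case: l kl ll => [|l] kl ll /=;
  first by do 11 (case: k kl => [|k] kl; [by first [done | rewrite /=; ring] |])).
by [].
Qed.

Lemma T238_apollonian_property : apollonian_property 2 (@T238_packing R).
Proof.
move=> n /packingP[w ->].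
have tan (i j : I) : i != j -> act w (simplex i) ⋅ act w (simplex j) = 2.
  rewrite -(inj_eq val_inj) neq_ltn act_bform => /orP[ij|ji].
    by rewrite simplex_tangent // ij ltn_ord.
  by rewrite bformC simplex_tangent // ji ltn_ord.
exists (fun i : I => act w (simplex i)); split=> //.
- move=> i j ij; apply/eqP; apply/negPn/negP => /tan; rewrite ij act_bform.
  have /packingP[u ->] := simplex_packing (ltn_ord j).
  by rewrite act_bform nu_nu => h; have := ltr0n R 4; lra.
- move=> i; have /packingP[u ->] := simplex_packing (ltn_ord i).
  by apply/packingP; exists (w ++ u); rewrite act_cat.
- by exists ord0; rewrite simplex0.
Qed.

End Packing.

(** * Maximality *)

Section Maximal.
Variable R : realType.
Local Notation V := 'rV[R]_11.
Local Notation "x ⋅ y" := (bform x y) (at level 40).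
Local Notation b := (bvec R).
Local Notation I := 'I_11.
Local Notation nu := (nu R).
Local Notation delta := (delta R).
Implicit Types (x y z : V) (v w : seq I) (i j s t : I).

Lemma wallE x k : (k < 11)%N -> b (inord k) ⋅ x = nth 0
  [:: x#3 - 2 * x#0; x#2 - 2 * x#1; x#1 + x#3 - 2 * x#2; x#0 + x#2 + x#4 - 2 * x#3;
      x#3 + x#5 - 2 * x#4; x#4 + x#6 - 2 * x#5; x#5 + x#7 - 2 * x#6;
      x#6 + x#8 - 2 * x#7; x#7 + x#9 - 2 * x#8; x#8 + x#10 - 2 * x#9; x#9 - 2 * x#10] k.
Proof.
move=> lk; rewrite bformE !bvec_crd // inordK //.
by do 11 (case: k lk => [|k] lk /=; first by ring).
Qed.

(* The wall values determine the coordinates through the inverse Gram matrix,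
   all of whose entries except the last are nonnegative. *)
Lemma dominant_null_nu x : dominant x -> x ⋅ x = 0 -> nu ⋅ x <= 0.
Proof.
move=> dx xx; rewrite leNgt bform_nu pmulr_rgt0 //; apply/negP => x10.
have w k (lk : (k < 11)%N) := @wallE x k lk.
(* Together with [x#10 > 0], the wall inequalities force every coordinate to be positive. *)
have pos k : (k < 11)%N -> 0 < x#k.
  have d m := dx (inord m).
  have d0 := d 0; have d1 := d 1; have d2 := d 2; have d3 := d 3; have d4 := d 4.
  have d5 := d 5; have d6 := d 6; have d7 := d 7; have d8 := d 8; have d9 := d 9.
  have d10 := d 10; rewrite !w //= {d w xx dx} in d0 d1 d2 d3 d4 d5 d6 d7 d8 d9 d10.
  by do 11 (case: k => [|k]; first by move=> _; lra).
(* The norm 0 is a sum of products of a positive coordinate and a nonnegative wall value, so all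
   wall values vanish. Then x = 0, against [x#10 > 0]. *)
have z k : b (inord k) ⋅ x = 0.
  have : \sum_i x 0 i * (b i ⋅ x) == 0 by rewrite -bform_sum xx.
  rewrite psumr_eq0 => [/allP h|i _]; last by rewrite mulr_ge0 // crd_ord ltW // pos.
  have := h (inord k); rewrite mem_index_enum => /(_ isT) /=.
  by rewrite mulf_eq0 crd_ord gt_eqF ?pos // => /eqP.
have z0 := z 0; have z1 := z 1; have z2 := z 2; have z3 := z 3; have z4 := z 4.
have z5 := z 5; have z6 := z 6; have z7 := z 7; have z8 := z 8; have z9 := z 9.
have z10 := z 10; rewrite !w //= in z0 z1 z2 z3 z4 z5 z6 z7 z8 z9 z10; lra.
Qed.

(** Here integrality of z makes the products with [rho2] natural numbers, so well-ordering replaces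
    the finiteness argument used for timelike vectors. *)
Lemma null_descent z : integral z -> light_cone z -> exists w, dominant (act w z).
Proof.
move=> iz lz; pose P n := `[< exists w, act w z ⋅ rho2 R = n%:R >].
have pos w : exists n, act w z ⋅ rho2 R = n%:R.
  have iw : act w z ⋅ rho2 R \is a Num.int.
    by apply: integral_bform; [exact: integral_act|exact: integral_iv].
  have : 0 <= act w z ⋅ rho2 R.
    have m0 : 0 < act (rev w) (rho2 R) ⋅ act (rev w) (rho2 R).
      by rewrite act_bform rho2_gt0.
    have am : 0 < ca (act (rev w) (rho2 R)).
      by apply: act_forward; [exact: rho2_gt0|exact: ca_rho2].
    rewrite act_adj; have /light_coneP[zz [az|[c c0 ->]]] := lz.
      by apply/ltW/causal_gt0 => //; rewrite zz.
    by rewrite bformZl bformC bform_delta mulr_ge0 // ltW.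
  by move: iw => /intrP[[n|n] ->]; [exists n|rewrite ler0z].
have ex : exists n, P n by have [n hn] := pos [::]; exists n; apply/asboolP; exists [::].
case: (ex_minnP ex) => n /asboolP[w hw] nmin; exists w => i.
have [m hm] := pos (i :: w).
have nm : (n <= m)%N by apply: nmin; apply/asboolP; exists (i :: w).
have : act w z ⋅ rho2 R <= act (i :: w) z ⋅ rho2 R by rewrite hw hm ler_nat.
by rewrite /= /refl bformDl bformZl rho2_bvec lerDl pmulr_lge0.
Qed.

Lemma integral_null_not_residual z : integral z -> light_cone z ->
  exists2 n, T238_packing n & n ⋅ z <= 0.
Proof.
move=> iz lz; have [w dw] := null_descent iz lz.
exists (act (rev w) nu); first by apply/packingP; exists (rev w).
rewrite act_adj revK; apply: dominant_null_nu => //.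
by rewrite act_bform; case: lz.
Qed.

Lemma integral_delta : integral delta.
Proof.
have -> : delta = iv R [:: 3; 2; 4; 6; 5; 4; 3; 2; 1; 0; 0]%Z; last exact: integral_iv.
apply: crdP => k lk; rewrite /delta /mkv !crd_mkrow // !crd0.
by do 11 (case: k lk => [|k] lk /=; first by field).
Qed.

Lemma bform_continuous (p : V) : continuous (fun x => p ⋅ x).
Proof.
have -> : (fun x => p ⋅ x) = \sum_i (fun x => x 0 i * (b i ⋅ p)).
  by apply/funext => x; rewrite fct_sumE bformC bform_sum.
apply: (big_ind (fun f : V -> R => continuous f)) => [|f g hf hg|i _] x.
- exact: (@cst_continuous _ _ (0 : R)).
- exact: (continuousD (hf x) (hg x)).
- apply: (@continuousM R V (fun x => x 0 i) (fun=> b i ⋅ p)); last exact: cst_continuous.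
  exact: coord_continuous.
Qed.

Lemma bform_sqr_continuous : continuous (fun x : V => x ⋅ x).
Proof.
have -> : (fun x : V => x ⋅ x) = \sum_i (fun x => x 0 i * (b i ⋅ x)).
  by apply/funext => x; rewrite fct_sumE bform_sum.
apply: (big_ind (fun f : V -> R => continuous f)) => [|f g hf hg|i _] x.
- exact: (@cst_continuous _ _ (0 : R)).
- exact: (continuousD (hf x) (hg x)).
- apply: (@continuousM R V (fun x => x 0 i) (fun x => b i ⋅ x)).
    exact: coord_continuous.
  exact: bform_continuous.
Qed.

(* The second intersection of the null cone with the line through x and delta. *)
Definition null_proj x : V := x - ((x ⋅ x) / (2 * (delta ⋅ x))) *: delta.

Lemma null_projP x : ca x != 0 -> null_proj x ⋅ null_proj x = 0 /\ ca (null_proj x) = ca x.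
Proof.
move=> ax; rewrite /null_proj -scaleNr; split; last first.
  by rewrite !clE /delta ca_mkv mulr0 addr0.
by rewrite !bformlE !(bformC delta x) !bform_delta /delta ca_mkv; field.
Qed.

Lemma null_proj_continuous x : ca x != 0 -> {for x, continuous null_proj}.
Proof.
move=> ax.
apply: (@continuousB R V V id (fun q => ((q ⋅ q) / (2 * (delta ⋅ q))) *: delta)).
  exact: cvg_id.
apply: continuousZr_tmp.
apply: (@continuousM R V (fun q => q ⋅ q) (fun q => (2 * (delta ⋅ q))^-1)).
  exact: bform_sqr_continuous.
apply: (@continuousV R V (fun q => 2 * (delta ⋅ q))).
  by rewrite bformC bform_delta mulf_neq0 ?pnatr_eq0.
apply: (@continuousM R V (fun=> 2) (fun q => delta ⋅ q)); first exact: cst_continuous.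
exact: bform_continuous.
Qed.

Lemma nbhs_rational x (A : set V) : nbhs x A ->
  exists2 N : nat, (0 < N)%N & exists2 m, integral m & A (N%:R^-1 *: m).
Proof.
move=> /nbhs_ballP[e /= e0 he].
pose N := (Num.bound e^-1).+1.
have N0 : 0 < N%:R :> R by rewrite ltr0n.
have Ne : N%:R^-1 < e.
  have h1 : e^-1 < (Num.bound e^-1)%:R by apply: archi_boundP; rewrite invr_ge0 ltW.
  have h2 : (Num.bound e^-1)%:R <= N%:R :> R by rewrite ler_nat leqnSn.
  by rewrite invf_plt ?posrE //; exact: lt_le_trans h1 h2.
exists N => //; exists (\row_i (Num.floor (x 0 i * N%:R))%:~R).
  by move=> i; rewrite mxE.
apply: he; split=> // i j; rewrite ord1 /ball /= !mxE.
have /andP[h1 h2] := floor_itv (x 0 j * N%:R); rewrite intrD in h2.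
set f := (Num.floor _)%:~R in h1 h2 *.
have -> : x 0 j - N%:R^-1 * f = N%:R^-1 * (x 0 j * N%:R - f) by field; rewrite lt0r_neq0.
rewrite ger0_norm ?mulr_ge0 ?invr_ge0 ?(ltW N0) ?subr_ge0 //.
apply: le_lt_trans Ne; rewrite -[leRHS]mulr1 ler_wpM2l ?invr_ge0 ?(ltW N0) //; lra.
Qed.

Lemma residual_rayP x : residual_set (@T238_packing R) (ray x) ->
  forall n, T238_packing n -> 0 < n ⋅ x.
Proof.
move=> [y [ly hy] /= e] n Pn; have : ray x x by exists 1; rewrite /= ?scale1r.
by rewrite -e => -[c c0 <-]; rewrite bformZr mulr_gt0 // hy.
Qed.

(** A rational vector close to a representative x is projected to the cone along [delta]. The result
    still lies over U and is proportional to an integral null vector, hence not residual. *)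
Lemma T238_maximal : maximal_packing (@T238_packing R).
Proof.
move=> U [Ubd [O Oo OU]] Ures; apply/seteqP; split=> // r Ur.
have [x lx xr] := Ubd _ Ur; rewrite -xr in Ur.
have xO : O x.
  by have : (O `&` @light_cone R) x; [rewrite -OU|case].
have [xx [ax|[c c0 xd]]] := (light_coneP x).1 lx; last first.
  have [n Pn] := integral_null_not_residual integral_delta (light_delta R).
  by rewrite leNgt => /negP[]; have := residual_rayP (Ures _ Ur) Pn; rewrite xd bformZr pmulr_rgt0.
have ax0 := lt0r_neq0 ax.
have nA : nbhs x [set q | O (null_proj q) /\ 0 < delta ⋅ q].
  apply: filterI.
    apply: (null_proj_continuous ax0).
    have -> : null_proj x = x by rewrite /null_proj xx mul0r scale0r subr0.
    by apply: open_nbhs_nbhs.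
  have : \forall t \near (delta ⋅ x), 0 < t by apply: lt_nbhsr; rewrite bformC bform_delta.
  exact: bform_continuous.
have [N N0 [m im [Om am]]] := nbhs_rational nA.
set q := N%:R^-1 *: m in Om am.
rewrite bformC bform_delta in am.
have [nq aq] := null_projP (lt0r_neq0 am).
have lq : light_cone (null_proj q).
  by apply/light_coneP; split=> //; left; rewrite aq.
have Uq : U (ray (null_proj q)).
  have : (O `&` @light_cone R) (null_proj q) by [].
  by rewrite -OU => -[].
have N0' : 0 < N%:R :> R by rewrite ltr0n.
have am' : 0 < ca m by move: am; rewrite /q !clE pmulr_rgt0 // invr_gt0.
(* This factor clears both the denominator N of q and the one in [null_proj]. *)
pose k := 2 * N%:R * ca m.
have k0 : 0 < k by rewrite !mulr_gt0.
have zE : k *: null_proj q = (2 * ca m) *: m + (- (m ⋅ m)) *: delta.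
  rewrite /null_proj /q !bformlE (bformC delta) bform_delta scalerBr !scalerA -scaleNr.
  by congr (_ *: _ + _ *: _); rewrite /k; field; rewrite !lt0r_neq0.
have iz : integral (k *: null_proj q).
  rewrite zE; apply: integralD; apply: integralZ => //.
  - by rewrite rpredM ?rpred_nat //; exact: integral_crd.
  - by rewrite rpredN integral_bform.
  - exact: integral_delta.
have lz : light_cone (k *: null_proj q).
  apply/light_coneP; rewrite bformZl bformZr nq !mulr0; split=> //; left.
  by rewrite caZ aq mulr_gt0.
have [n Pn] := integral_null_not_residual iz lz.
by rewrite bformZr leNgt pmulr_rgt0 // (residual_rayP (Ures _ Uq) Pn).
Qed.

Theorem T238_apollonian : apollonian_packing (@T238_packing R).
Proof.
exists 2; split.
- exact: T238_is_packing.
- exact: T238_crystallographic.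
- exact: T238_maximal.
- exact: T238_apollonian_property.
Qed.

End Maximal.

(** * Roots of affine E8 *)

Section AffineRoots.
Variable R : realType.
Local Notation V := 'rV[R]_11.
Local Notation "x ⋅ y" := (bform x y) (at level 40).
Local Notation b := (bvec R).
Local Notation I := 'I_11.
Local Notation nu := (nu R).
Local Notation delta := (delta R).
Implicit Types (x y z n : V) (v w : seq I) (i j s t : I).

Definition reflv n x : V := x + (n ⋅ x) *: n.

(** Formulated through the reflection in n, so that n and -n are interchangeable and conjugating W
    by an isometry is easy to express. *)
Definition weyl_root n := exists w, forall x, act w x = reflv n x.

Lemma weyl_root_bvec i : weyl_root (b i).
Proof. by exists [:: i]. Qed.

Lemma weyl_rootN n : weyl_root (- n) -> weyl_root n.
Proof.
by move=> [w hw]; exists w => x; rewrite hw /reflv bformNl scaleNr scalerN opprK.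
Qed.

Lemma weyl_root_act w n : weyl_root n -> weyl_root (act w n).
Proof.
move=> [u hu]; exists (w ++ u ++ rev w) => x.
by rewrite !act_cat hu /reflv actD actZ actKV act_adj.
Qed.

Lemma integral_even x : integral x -> exists2 c, c \is a Num.int & x ⋅ x = 2 * c.
Proof.
move=> ix; have h k := @integral_crd _ _ k ix.
exists (- (x#0*x#0 + x#1*x#1 + x#2*x#2 + x#3*x#3 + x#4*x#4 + x#5*x#5 + x#6*x#6
       + x#7*x#7 + x#8*x#8 + x#9*x#9 + x#10*x#10)
  + (x#0*x#3 + x#1*x#2 + x#2*x#3 + x#3*x#4 + x#4*x#5 + x#5*x#6 + x#6*x#7
   + x#7*x#8 + x#8*x#9 + x#9*x#10)); last by rewrite bformE; ring.
by rewrite !(rpredD, rpredN, rpredM).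
Qed.

Lemma int_le_N1 (c : R) : c \is a Num.int -> c < 0 -> c <= -1.
Proof.
move=> /intrP[m ->]; rewrite ltrz0 => m0.
by rewrite -[-1]/((-1)%:~R) ler_int; lia.
Qed.

Definition affine n := [/\ integral n, n#9 = 0 & n#10 = 0].

Lemma affine_norm n : affine n -> n ⋅ n = 0 \/ n ⋅ n <= -2.
Proof.
move=> [i_n n9 _]; have [c ic e] := integral_even i_n.
have := ca_eq0_le0 n9; rewrite e => h.
have [->|c0] := eqVneq c 0; first by left; rewrite mulr0.
by right; have : c <= -1 by [apply: int_le_N1 => //; rewrite lt_def eq_sym c0; lra]; lra.
Qed.

Lemma delta_crd k : (k < 11)%N ->
  delta#k = nth 0 [:: 3; 2; 4; 6; 5; 4; 3; 2; 1; 0; 0] k.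
Proof.
move=> lk; rewrite /delta /mkv !crd_mkrow // !crd0.
by do 11 (case: k lk => [|k] lk /=; first by field).
Qed.

Lemma affine_null n : affine n -> n ⋅ n = 0 -> n = n#8 *: delta.
Proof.
move=> [_ n9 n10] nn; rewrite {1}(null_ca0 nn n9); congr (_ *: _).
by rewrite /cb n9 n10; ring.
Qed.

(* The form is negative semidefinite on the span of b_0..b_8 and even, so positive
   and negative parts of a mixed root would already have total norm at most -4. *)
Lemma affine_root_sign n : affine n -> n ⋅ n = -2 -> nonneg n \/ nonneg (- n).
Proof.
move=> [i_n n9 n10] nn.
pose part (f : R -> R) : V := \row_i (if 0 <= f (n 0 i) then f (n 0 i) else 0).
have aff f : (forall c, c \is a Num.int -> f c \is a Num.int) -> f 0 = 0 -> affine (part f).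
  move=> hf f0; split.
  - by move=> i; rewrite mxE; case: ifP => _; [exact: hf|exact: rpred0].
  - by rewrite /crd mxE -/(crd n 9) n9 f0 lexx.
  - by rewrite /crd mxE -/(crd n 10) n10 f0 lexx.
pose p := part id; pose q := part -%R.
have ap : affine p by apply: aff.
have aq : affine q by apply: aff => [c|]; rewrite ?rpredN ?oppr0.
have p0 : nonneg p by move=> i; rewrite mxE; case: ifP.
have q0 : nonneg q by move=> i; rewrite mxE; case: ifP.
have npq : n = p - q.
  apply/rowP => i; rewrite !mxE /= !oppr_ge0.
  by case: (ltgtP 0 (n 0 i)) => [h|h|<-]; rewrite ?oppr0 ?addr0 ?opprK ?add0r.
have pq0 i : p 0 i * q 0 i = 0.
  rewrite !mxE /= !oppr_ge0.
  by case: (ltgtP 0 (n 0 i)) => [h|h|<-]; rewrite ?oppr0 ?mul0r ?mulr0.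
have pq : 0 <= p ⋅ q.
  rewrite bform_sum; apply: sumr_ge0 => i _.
  rewrite bformC bform_sum mulr_sumr; apply: sumr_ge0 => j _.
  rewrite bform_bvec mulrA; have [->|ij] := eqVneq j i.
    by rewrite pq0 mul0r.
  by rewrite mulr_ge0 ?mulr_ge0 //; case: ifP.
(* A null part is a multiple of [delta], all of whose coefficients on b_0, ..., b_8 are nonzero;
   disjoint supports then kill one of the two parts. *)
have nullp r r' : affine r -> nonneg r -> nonneg r' -> affine r' ->
    (forall i, r 0 i * r' 0 i = 0) -> r ⋅ r = 0 -> r = 0 \/ r' = 0.
  move=> ar r0 r'0 [_ r'9 r'10] rr' rr.
  have e := affine_null ar rr; have [z|nz] := eqVneq (r#8) 0.
    by left; rewrite e z scale0r.
  right; apply: crdP => k lk; rewrite crd0.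
  have [k8|k8] := ltnP k 9; last first.
    by move: k lk k8; do 9 case=> //; case=> [//|[//|]].
  have : r#k * r'#k == 0 by rewrite /crd rr'.
  rewrite mulf_eq0 => /orP[|/eqP//]; rewrite {1}e crdZ delta_crd //.
  rewrite mulf_eq0 (negPf nz) /=.
  by do 9 (case: k lk k8 => [|k] lk k8 /=; first by rewrite ?oner_eq0 ?pnatr_eq0).
have e : n ⋅ n = p ⋅ p + q ⋅ q - 2 * (p ⋅ q).
  by rewrite {1 2}npq !bformlE (bformC q p); ring.
have [pp|pp] := affine_norm ap.
  have [z|z] := nullp p q ap p0 q0 aq pq0 pp.
    by right; rewrite npq z sub0r opprK.
  by left; rewrite npq z subr0.
have [qq|qq] := affine_norm aq.
  have [//|z|z] := nullp q p aq q0 p0 ap _ qq; first by move=> i; rewrite mulrC.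
    by left; rewrite npq z subr0.
  by right; rewrite npq z sub0r opprK.
rewrite nn in e; lra.
Qed.

Lemma affine_refl n i : (i < 9)%N -> affine n -> affine (refl i n).
Proof.
move=> i8 [i_n n9 n10]; split; first exact: integral_refl.
  by rewrite /refl crdD crdZ n9 bvec_crd // (gtn_eqF i8) mulr0 addr0.
by rewrite /refl crdD crdZ n10 bvec_crd // (gtn_eqF (leqW i8)) mulr0 addr0.
Qed.

Lemma bound_ex (c : R) : exists m : nat, c < m%:R.
Proof.
have [c0|c0] := leP 0 c; last by exists 0%N.
by exists (Num.bound c); apply: archi_boundP.
Qed.

(** As n ⋅ n < 0, a nonnegative n has a b_i in its support with b_i ⋅ n < 0. That reflection lowers
    the coefficient sum, and the image is again nonnegative unless n is b_i. *)
Lemma affine_weyl_root n : affine n -> n ⋅ n = -2 -> weyl_root n.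
Proof.
have pos n0 : affine n0 -> n0 ⋅ n0 = -2 -> nonneg n0 -> weyl_root n0; last first.
  move=> an nn; have [|h] := affine_root_sign an nn; first exact: pos.
  apply: weyl_rootN; apply: pos => //; last by rewrite bformNl bformNr opprK.
  case: an => i_n n9 n10; split; rewrite ?crdN ?n9 ?n10 ?oppr0 //.
  by move=> i; rewrite mxE rpredN.
have [m] := bound_ex (\sum_i n0 0 i).
elim: m n0 => [|m IH] n0 hm an nn nn0.
  by move: hm; rewrite ltNge sumr_ge0.
have [i ni] : exists i, n0 0 i * (b i ⋅ n0) < 0.
  apply/not_existsP => h; have : 0 <= n0 ⋅ n0.
    by rewrite bform_sum; apply: sumr_ge0 => i _; rewrite leNgt; apply/negP/h.
  by rewrite nn; lra.
have [i_n n9 n10] := an.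
have ni0 : n0 0 i != 0 by apply: contraTneq ni => ->; rewrite mul0r ltxx.
have nip : 0 < n0 0 i by rewrite lt_def ni0 nn0.
have bi : b i ⋅ n0 < 0 by rewrite -(pmulr_rlt0 _ nip).
have i8 : (i < 9)%N.
  rewrite ltnNge; apply: contra ni0 => i9; rewrite crd_ord.
  have : (i : nat) = 9%N \/ (i : nat) = 10%N.
    case: i {ni nip bi} i9 => k /= lk k9.
    by have [->|nk] := eqVneq k 9%N; [left|right; apply/eqP; rewrite eqn_leq -ltnS lk ltn_neqAle eq_sym nk].
  by case=> ->; rewrite ?n9 ?n10.
have an' := affine_refl i8 an.
have nn' : refl i n0 ⋅ refl i n0 = -2 by rewrite refl_bform.
have c1 : b i ⋅ n0 <= -1.
  by apply: int_le_N1 => //; apply: integral_bform => //; exact: integral_bvec.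
have [s|s] := affine_root_sign an' nn'.
  rewrite -(reflK i n0); apply: (@weyl_root_act [:: i]); apply: IH => //.
  by rewrite /refl sum_coord_bvec; move: hm; rewrite -natr1; lra.
(* The reflection changes only coordinate i, so a nonpositive image leaves no other coordinate. *)
have e : n0 = n0 0 i *: b i.
  apply/rowP => j; rewrite !mxE eqxx /=; have [->|ji] := eqVneq j i; first by rewrite mulr1.
  rewrite mulr0; apply/eqP; rewrite eq_le nn0 andbT -oppr_ge0.
  by have := s j; rewrite !mxE (negPf ji) mulr0 addr0.
have : n0 0 i = 1.
  have : (n0 0 i) ^+ 2 = 1.
    by have := nn; rewrite {1 2}e bformZl bformZr bform_bvec_self expr2; lra.
  by move=> /eqP; rewrite sqrf_eq1 => /orP[/eqP//|/eqP h]; move: nip; rewrite h; lra.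
by move=> e1; rewrite e e1 scale1r; exact: weyl_root_bvec.
Qed.

Definition affine_word w := all (fun i => (i < 9)%N) w.

Lemma affine_word_fix w x : affine_word w -> (forall i, (i < 9)%N -> b i ⋅ x = 0) ->
  act w x = x.
Proof.
move=> aw hx; elim: w aw => //= i w IH /andP[i8 aw].
by rewrite IH // /refl hx // scale0r addr0.
Qed.

Lemma affine_word_rev w : affine_word w -> affine_word (rev w).
Proof. by rewrite /affine_word all_rev. Qed.

(* Reflections decrease n . rho2, which is bounded below because 60 n - rho2 is
   orthogonal to delta. In the fundamental alcove the coefficients of delta force
   n = b_9. *)
Lemma level1_orbit n : integral n -> n#9 = 1 -> n#10 = 0 -> n ⋅ n = -2 ->
  exists2 w, affine_word w & act w n = b (inord 9).
Proof.
(* 60 is [ca] of [rho2]; the bound is the expansion of the norm of [60 *: x - rho2], which is at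
   most 0. *)
pose B : R := (rho2 R ⋅ rho2 R - 7200) / 120.
have lower x : x#9 = 1 -> x ⋅ x = -2 -> B <= x ⋅ rho2 R.
  move=> x9 xx; have : ca (60 *: x - rho2 R) = 0.
    by rewrite /ca !crdE x9 crd_mkrow //=; ring.
  by move=> /ca_eq0_le0; rewrite !bformlE (bformC (rho2 R) x) xx /B; lra.
have [m] := bound_ex (n ⋅ rho2 R - B).
elim: m n => [|m IH] n hm i_n n9 n10 nn.
  by have := lower n n9 nn; lra.
have [[i [i8 bi]]|h] := pselect (exists i : I, (i < 9)%N /\ b i ⋅ n < 0).
  have c1 : b i ⋅ n <= -1.
    by apply: int_le_N1 => //; apply: integral_bform => //; exact: integral_bvec.
  have [|||||w aw e] := IH (refl i n).
  - by rewrite /refl bformDl bformZl rho2_bvec; move: hm; rewrite -natr1; lra.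
  - exact: integral_refl.
  - by rewrite /refl crdD crdZ n9 bvec_crd // (gtn_eqF i8) mulr0 addr0.
  - by rewrite /refl crdD crdZ n10 bvec_crd // (gtn_eqF (leqW i8)) mulr0 addr0.
  - by rewrite refl_bform.
  by exists (rcons w i); rewrite ?act_rcons // /affine_word all_rcons i8.
have pos k : (k < 9)%N -> 0 <= b (inord k) ⋅ n.
  move=> k9; rewrite leNgt; apply/negP => bk; apply: h; exists (inord k).
  by rewrite inordK // (ltn_trans k9).
have bpos (m' : I) : 0 <= delta 0 m' * (b m' ⋅ n).
  have [m9|] := ltnP m' 9.
    apply: mulr_ge0; last by have := pos m' m9; rewrite inord_val.
    rewrite crd_ord delta_crd // {m9}; case: m' => l /= ll.
    by do 11 (case: l ll => [|l] ll; first by rewrite /= ?ler0n).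
  rewrite crd_ord delta_crd //; case: m' => l /= ll.
  by do 11 (case: l ll => [|l] ll; first by rewrite //= mul0r).
(* [delta ⋅ n = 1] is a sum of nonnegative terms in which these wall values have coefficient at
   least 2, so as integers they vanish. *)
have zero l : (l < 8)%N -> b (inord l) ⋅ n = 0.
  move=> l8; have l9 : (l < 9)%N := leqW l8.
  have l11 : (l < 11)%N by rewrite (ltn_trans l8).
  have d2 : 2 <= delta 0 (inord l).
    rewrite -/(crd delta l) delta_crd // {l9 l11}.
    by do 8 (case: l l8 => [|l] l8; first by rewrite /= ler_nat).
  have : delta 0 (inord l) * (b (inord l) ⋅ n) <= 1.
    have <- : delta ⋅ n = 1 by rewrite bformC bform_delta.
    by rewrite [leRHS]bform_sum (bigD1 (inord l)) //= lerDl sumr_ge0.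
  have := pos l l9; set z := b _ ⋅ n => z0 dz.
  have z1 : 2 * z <= 1 by apply: le_trans dz; rewrite ler_wpM2r.
  apply/eqP; rewrite eq_le z0 andbT leNgt; apply/negP => zp.
  have : - z <= -1; last by lra.
  apply: int_le_N1; last by rewrite oppr_lt0.
  by rewrite rpredN; apply: integral_bform => //; exact: integral_bvec.
have w (l : nat) (ll : (l < 11)%N) := @wallE _ n l ll.
have z0 := zero 0 isT; have z1 := zero 1 isT; have z2 := zero 2 isT.
have z3 := zero 3 isT; have z4 := zero 4 isT; have z5 := zero 5 isT.
have z6 := zero 6 isT; have z7 := zero 7 isT.
rewrite !w //= in z0 z1 z2 z3 z4 z5 z6 z7.
clear w zero bpos pos h IH hm lower i_n.
(* Thus n = k [delta] + b_9 with k = [n#1 / 2], and the norm 2 k - 2 = -2 gives k = 0. *)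
have e2 : n#2 = 2 * n#1 by lra.
have e3 : n#3 = 3 * n#1 by lra.
have e0 : n#0 = 3 / 2 * n#1 by lra.
have e4 : n#4 = 5 / 2 * n#1 by lra.
have e5 : n#5 = 2 * n#1 by lra.
have e6 : n#6 = 3 / 2 * n#1 by lra.
have e7 : n#7 = n#1 by lra.
have e8 : n#8 = n#1 / 2 by lra.
have e1 : n#1 = 0.
  by move: nn; rewrite bformE e0 e2 e3 e4 e5 e6 e7 e8 n9 n10; clear; lra.
exists [::] => //=; apply: crdP => k lk; rewrite bvec_crd // inordK //.
do 11 (case: k lk => [|k] lk;
  first by rewrite /= ?e0 ?e2 ?e3 ?e4 ?e5 ?e6 ?e7 ?e8 ?n9 ?n10 ?e1 ?mulr0 ?mul0r).
by [].
Qed.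

End AffineRoots.

(** * The E8 lattice and its symmetries *)

Section E8.
Variable R : realType.
Local Notation V := 'rV[R]_11.
Local Notation "x ⋅ y" := (bform x y) (at level 40).
Local Notation b := (bvec R).
Local Notation I := 'I_11.
Local Notation nu := (nu R).
Local Notation E8 := (@E8_lattice R).
Implicit Types (x y z n : V) (u t : 'rV[R]_8) (i j : I).

Lemma sum8E u : \sum_i u 0 i = u#0 + u#1 + u#2 + u#3 + u#4 + u#5 + u#6 + u#7.
Proof.
transitivity (\sum_(0 <= i < 8) u#i).
  by rewrite big_mkord; apply: eq_bigr => i _; rewrite crd_ord.
by rewrite unlock /=; ring.
Qed.

Lemma int_half (c : R) : c \is a Num.int ->
  c / 2 \is a Num.int \/ c / 2 - 2^-1 \is a Num.int.
Proof.
move=> /intrP[m ->]; have [k [e|e]] : exists k : int, m = k + k \/ m = k + k + 1.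
  by exists (m %/ 2)%Z; lia.
- left; rewrite e rmorphD /= (_ : _ / 2 = k%:~R) //; by field.
- right; rewrite e !rmorphD /= (_ : _ / 2 - _ = k%:~R) //; by field.
Qed.

(** One condition replaces the alternative between integers and half-integers: for k = 7 it says
    that twice the last coordinate is an integer, whose parity decides the case. *)
Lemma E8P u : E8 u <->
  (forall k, (k < 8)%N -> u#k + u#7 \is a Num.int) /\ (\sum_i u 0 i) / 2 \is a Num.int.
Proof.
split=> -[h hs]; split=> //.
  move=> k lk; case: h => h; first by apply: rpredD; apply: h.
  rewrite (_ : _ + _ = (u#k - 2^-1) + (u#7 - 2^-1) + 1); last by field.
  by apply: rpredD (rpred1 _); apply: rpredD; apply: h.
have [c|c] := int_half (h 7 isT); [left|right] => i; rewrite crd_ord.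
  rewrite (_ : u#i = (u#i + u#7) - (u#7 + u#7) / 2); last by field.
  by apply: rpredB => //; apply: h.
rewrite (_ : u#i - _ = (u#i + u#7) - ((u#7 + u#7) / 2 - 2^-1) - 1); last by field.
by apply: rpredB (rpred1 _); apply: rpredB => //; apply: h.
Qed.

Lemma cu_E8 x : integral x -> E8 (cu x).
Proof.
move=> ix; have h k := @integral_crd _ _ k ix; apply/E8P; split=> [k lk|]; last first.
  rewrite sum8E /cu !crd_mkrow //=.
  rewrite (_ : _ / 2 = - x#1 + x#0 - x#8); last by field.
  by rewrite !(rpredD, rpredN).
have -> : (cu x)#k + (cu x)#7 = nth 0
  [:: x#1 + x#0 - x#2 - x#8; x#0 + x#2 - x#3 - x#8; x#3 - x#4 - x#8;
      x#4 - x#5 - x#8; x#5 - x#6 - x#8; x#6 - x#7 - x#8; x#7 - x#8 - x#8;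
      x#1 - x#8 - x#8] k.
  rewrite /cu !crd_mkrow //=.
  by do 8 (case: k lk => [|k] lk /=; first by field).
by do 8 (case: k lk => [|k] lk /=; first by rewrite !(rpredD, rpredN)).
Qed.

(** Converse to [cu_E8]: in the frame the integral vectors form E8 x 2Z x Z x Z. Each coordinate is
    rebuilt from the integers [u#k + u#7], half the coordinate sum, s / 2, a and c. *)
Lemma mkv_integral u s a c : E8 u -> s / 2 \is a Num.int -> a \is a Num.int ->
  c \is a Num.int -> integral (mkv u s a c).
Proof.
move=> /E8P[h hs] i_s ia ic.
have i10 : - s / 2 \is a Num.int by rewrite mulNr rpredN.
have i8 : c + a - - s / 2 \is a Num.int by rewrite rpredB ?rpredD.
have e : forall k, (k < 11)%N -> (mkv u s a c)#k \is a Num.int; last first.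
  by move=> i; rewrite crd_ord e.
set x8 := c + a - - s / 2 in i8.
have h7 := h 7 isT; have h6 := h 6 isT; have h5 := h 5 isT; have h4 := h 4 isT.
have h3 := h 3 isT; have h2 := h 2 isT; have h1 := h 1 isT; have h0 := h 0 isT.
rewrite sum8E in hs.
pose x7 := u#6 + u#7 + x8 + x8; pose x6 := u#5 + u#7 + x8 + x7.
pose x5 := u#4 + u#7 + x8 + x6; pose x4 := u#3 + u#7 + x8 + x5.
pose x3 := u#2 + u#7 + x8 + x4.
pose x0 := (u#0 + u#1 + u#2 + u#3 + u#4 + u#5 + u#6 + u#7) / 2 + (u#7 + u#7) + x8 + x8 + x8.
have i7 : x7 \is a Num.int by do 2 (apply: rpredD => //).
have i6 : x6 \is a Num.int by do 2 (apply: rpredD => //).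
have i5 : x5 \is a Num.int by do 2 (apply: rpredD => //).
have i4 : x4 \is a Num.int by do 2 (apply: rpredD => //).
have i3 : x3 \is a Num.int by do 2 (apply: rpredD => //).
have i0 : x0 \is a Num.int by do 4 (apply: rpredD => //).
have i1 : u#7 + u#7 + x8 + x8 \is a Num.int by do 2 (apply: rpredD => //).
have i2 : x0 - (u#0 + u#7) + (u#7 + u#7) + x8 \is a Num.int.
  by rewrite rpredD // rpredD // rpredB.
move=> k lk.
have -> : (mkv u s a c)#k = nth 0 [:: x0; u#7 + u#7 + x8 + x8;
    x0 - (u#0 + u#7) + (u#7 + u#7) + x8; x3; x4; x5; x6; x7; x8; a; - s / 2] k.
  rewrite /mkv crd_mkrow // -/x8.
  do 11 (case: k lk => [|k] lk; first by
    rewrite /= /x0 ?/x3 ?/x4 ?/x5 ?/x6 ?/x7; field).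
  by [].
by do 11 (case: k lk => [|k] lk //).
Qed.

(** Lets E8 inherit closure, integrality and evenness from the root lattice. *)
Lemma E8_ex u : E8 u -> exists2 x, integral x & u = cu x /\ x = mkv u 0 0 0.
Proof.
move=> hu; exists (mkv u 0 0 0); last by rewrite cu_mkv.
by apply: mkv_integral => //; rewrite ?mul0r ?rpred0.
Qed.

Lemma E8_0 : E8 0.
Proof.
have -> : 0 = cu (0 : V) by rewrite -(scale0r (0 : V)) cuZ scale0r.
by apply: cu_E8 => i; rewrite mxE rpred0.
Qed.

Lemma E8_lincomb c u t : c \is a Num.int -> E8 u -> E8 t -> E8 (u + c *: t).
Proof.
move=> ic /E8_ex[x ix [-> _]] /E8_ex[y iy [-> _]].
by rewrite -cuZ -cuD; apply: cu_E8; apply: integralD => //; apply: integralZ.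
Qed.

Lemma E8B u t : E8 u -> E8 t -> E8 (u - t).
Proof. by move=> hu ht; rewrite -scaleN1r; apply: E8_lincomb; rewrite ?rpredN ?rpred1. Qed.

Lemma E8_dot_mkv u t : eucl_dot u t = - (mkv u 0 0 0 ⋅ mkv t 0 0 0).
Proof. by rewrite frameE !mkvE; field. Qed.

Lemma E8_dot u t : E8 u -> E8 t -> eucl_dot u t \is a Num.int.
Proof.
move=> /E8_ex[x ix [_ ex]] /E8_ex[y iy [_ ey]].
by rewrite E8_dot_mkv -ex -ey rpredN integral_bform.
Qed.

Lemma E8_norm u : E8 u -> eucl_dot u u / 2 \is a Num.int.
Proof.
move=> /E8_ex[x ix [_ ex]]; have [c ic e] := integral_even ix.
rewrite E8_dot_mkv -ex e (_ : _ / 2 = - c); last by field.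
by rewrite rpredN.
Qed.

(* The Lorentz transformation that acts on R^8 as u |-> u Q + t. *)
Definition motion (Q : 'M[R]_8) t x : V :=
  mkv (cu x *m Q + ca x *: t) (cs x) (ca x)
    (cb x + eucl_dot (cu x *m Q) t + ca x * eucl_dot t t / 2).

Section Motion.
Variables (Q : 'M[R]_8) (t : 'rV[R]_8).
Hypothesis QQ : Q *m Q^T = 1%:M.

Lemma dot_orthogonal u u' : eucl_dot (u *m Q) (u' *m Q) = eucl_dot u u'.
Proof. by rewrite /eucl_dot trmx_mul mulmxA -[u *m Q *m Q^T]mulmxA QQ mulmx1. Qed.

Lemma motion_bform x y : motion Q t x ⋅ motion Q t y = x ⋅ y.
Proof.
by rewrite !frameE !mkvE !dotE !dot_orthogonal (dotC t (cu y *m Q)); field.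
Qed.

Lemma motion_linear c x y : motion Q t (x + c *: y) = motion Q t x + c *: motion Q t y.
Proof.
apply: frame_ext; rewrite !clE !mkvE ?clE.
- by rewrite mulmxDl -scalemxAl; apply/rowP => k; rewrite !mxE; ring.
- by [].
- by [].
- by rewrite mulmxDl -scalemxAl !dotE; field.
Qed.

Lemma motion_reflv n x : motion Q t (reflv n x) = reflv (motion Q t n) (motion Q t x).
Proof. by rewrite /reflv motion_linear motion_bform. Qed.

Lemma motion_fix x : cu x = 0 -> ca x = 0 -> motion Q t x = x.
Proof.
move=> u0 a0; apply: frame_ext; rewrite !mkvE ?u0 ?a0 ?mul0mx ?scale0r ?addr0 //.
by rewrite dot0l !mul0r !addr0.
Qed.

Hypothesis EQ : forall u, E8 u -> E8 (u *m Q).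
Hypothesis Et : E8 t.

Lemma motion_weyl_root i : weyl_root (motion Q t (b i)).
Proof.
have cui := cu_E8 (integral_bvec R i).
have icb : cb (b i) \is a Num.int by rewrite /cb !(rpredD, rpredN) //; exact: integral_bvec.
have nn : motion Q t (b i) ⋅ motion Q t (b i) = -2 by rewrite motion_bform bform_bvec_self.
have idot : eucl_dot (cu (b i) *m Q) t \is a Num.int by apply: E8_dot => //; exact: EQ.
have [i9|i9|i9] := ltngtP (i : nat) 9%N.
- have a0 : ca (b i) = 0 by rewrite ca_bvec // ltn_eqF.
  have s0 : cs (b i) = 0 by rewrite /cs bvec_crd // (gtn_eqF (leqW i9)) mulr0.
  apply: affine_weyl_root => //; split.
  + rewrite /motion a0 s0 scale0r !mul0r !addr0.
    apply: mkv_integral; [exact: EQ|by rewrite mul0r rpred0|exact: rpred0|].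
    exact: rpredD.
  + by rewrite -/(ca _) mkvE.
  + by have := mkvE; rewrite /motion /mkv crd_mkrow //= s0 oppr0 mul0r.
- have i10 : (i : nat) = 10%N by apply/eqP; rewrite eqn_leq -ltnS ltn_ord.
  rewrite motion_fix; first exact: weyl_root_bvec.
    apply: crdP => k lk; rewrite crd0 /cu crd_mkrow // !bvec_crd // !i10 /=.
    by do 8 (case: k lk => [|k] lk /=; first by field).
  by rewrite ca_bvec // i10.
- have a1 : ca (b i) = 1 by rewrite /ca bvec_crd // i9.
  have s0 : cs (b i) = 0 by rewrite /cs bvec_crd // i9 mulr0.
  have [] := @level1_orbit _ (motion Q t (b i)).
  + rewrite /motion a1 s0 scale1r mul1r.
    apply: mkv_integral; rewrite ?mul0r ?rpred0 ?rpred1 //.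
      by rewrite -[t]scale1r; apply: E8_lincomb; rewrite ?rpred1 //; exact: EQ.
    by apply: rpredD; [exact: rpredD|exact: E8_norm].
  + by rewrite -/(ca _) mkvE.
  + by rewrite /motion /mkv crd_mkrow //= s0 oppr0 mul0r.
  + by [].
  + move=> w _ e; rewrite -[motion _ _ _](actK w) e.
    by apply: weyl_root_act; apply: weyl_root_bvec.
Qed.

Lemma cu_nu : cu nu = 0.
Proof.
apply: crdP => k lk; rewrite crd0 /cu crd_mkrow // nuE !crd_mkrow //=.
by do 8 (case: k lk => [|k] lk /=; first by field).
Qed.

(** Induction on the word: a motion turns the reflection in b_i into the one in its image, which
    lies in W, and it fixes nu. *)
Lemma motion_packing n : @T238_packing R n -> @T238_packing R (motion Q t n).
Proof.
move=> /packingP[w ->]; elim: w => [|i w /packingP[v IH]] /=; apply/packingP.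
  exists [::]; rewrite motion_fix //; first exact: cu_nu.
  by rewrite /ca nuE crd_mkrow.
have [u hu] := motion_weyl_root i; exists (u ++ v).
by rewrite act_cat hu -IH -motion_reflv.
Qed.

End Motion.

End E8.

(** * The perspective from delta *)

Section Perspective.
Variable R : realType.
Local Notation V := 'rV[R]_11.
Local Notation E9 := 'rV[R]_9.
Local Notation "x ⋅ y" := (bform x y) (at level 40).
Local Notation b := (bvec R).
Local Notation I := 'I_11.
Local Notation nu := (nu R).
Local Notation delta := (delta R).
Local Notation E8 := (@E8_lattice R).
Local Notation P := (@T238_packing R).
Implicit Types (x y z n : V) (u t : 'rV[R]_8) (i j : I) (p : E9) (q : option E9).

Variables (H : {vspace E9}) (M : 'M[R]_(8, 9)) (v : E9).
Hypothesis MM : M *m M^T = 1%:M.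
Hypothesis MH : forall u, u *m M \in H.
Hypothesis vH : orthogonal_to H v.
Hypothesis vv : eucl_dot v v = 1 / 2.

Lemma dot_M u t : eucl_dot (u *m M) (t *m M) = eucl_dot u t.
Proof. by rewrite /eucl_dot trmx_mul mulmxA -[u *m M *m M^T]mulmxA MM mulmx1. Qed.

Lemma dot_Mv u : eucl_dot (u *m M) v = 0.
Proof. exact: vH. Qed.

Lemma trM_v : v *m M^T = 0.
Proof.
apply: dot_eq0; have := dot_Mv (v *m M^T).
by rewrite dotC /eucl_dot trmx_mul mulmxA => ->.
Qed.

(** The rows of M and [Num.sqrt 2 *: v] are nine orthonormal vectors, so the square matrix K they
    form also satisfies [K^T *m K = 1%:M]. *)
Lemma frame_complete p : p = p *m M^T *m M + (2 * eucl_dot p v) *: v.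
Proof.
pose K : 'M[R]_(8 + 1, 9) := col_mx M (Num.sqrt 2 *: v).
have Mv : M *m v^T = 0 by rewrite -[M]trmxK -trmx_mul trM_v trmx0.
have vv' : v *m v^T = (1 / 2)%:M.
  by rewrite [LHS]mx11_scalar; congr _%:M; rewrite -vv /eucl_dot.
have K1 : K *m K^T = 1%:M.
  rewrite /K tr_col_mx mul_col_row MM linearZ /= -!scalemxAl -!scalemxAr.
  rewrite Mv trM_v vv' !scaler0 scalerA -expr2 sqr_sqrtr // scale_scalar_mx.
  by rewrite (_ : 2 * (1 / 2) = 1) -?scalar_mx_block //; field.
have K2 : K^T *m K = 1%:M by exact: (@mulmx1C R 9 K K^T K1).
rewrite -{1}[p]mulmx1 -K2 /K tr_col_mx mul_row_col mulmxDr !mulmxA; congr (_ + _).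
rewrite -scalemxAr linearZ /= -scalemxAr -scalemxAl scalerA -expr2 sqr_sqrtr // -scalerA; congr (_ *: _).
by rewrite [p *m v^T]mx11_scalar mul_scalar_mx.
Qed.

(* The origin is moved to v, the centre of the inversion sigma. *)
Definition xc p := (p - v) *m M^T.
Definition sc p := 2 * eucl_dot (p - v) v.
Definition pos u (s : R) : E9 := v + u *m M + s *: v.

Lemma posK p : pos (xc p) (sc p) = p.
Proof. by rewrite /pos -addrA -[_ + sc p *: v]frame_complete addrC subrK. Qed.

Lemma pos_sub u s : pos u s - v = u *m M + s *: v.
Proof. by rewrite /pos; apply/rowP => k; rewrite !mxE; ring. Qed.

Lemma xc_pos u s : xc (pos u s) = u.
Proof.
by rewrite /xc pos_sub mulmxDl -mulmxA MM mulmx1 -scalemxAl trM_v scaler0 addr0.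
Qed.

Lemma sc_pos u s : sc (pos u s) = s.
Proof. by rewrite /sc pos_sub !dotE dot_Mv vv; field. Qed.

Lemma dist_pos u s u' s' :
  eucl_dist (pos u s) (pos u' s') ^+ 2 = eucl_dot (u - u') (u - u') + (s - s') ^+ 2 / 2.
Proof.
rewrite eucl_dist_sqr; have -> : pos u s - pos u' s' = (u - u') *m M + (s - s') *: v.
  by rewrite /pos mulmxBl; apply/rowP => k; rewrite !mxE; ring.
move: (u - u') (s - s') => w r.
by rewrite !dotDl !dotDr dot_M !dotZl !dotZr (dotC v (_ *m M)) dot_Mv vv; field.
Qed.

(** The paraboloid model: [ca] is 1 and nullity forces [cb] to be half the squared distance to
    [v]. *)
Definition lift u s : V := mkv u s 1 ((eucl_dot u u + s ^+ 2 / 2) / 2).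

Definition olift q : V := if q is Some p then lift (xc p) (sc p) else delta.

Lemma lift_null u s : lift u s ⋅ lift u s = 0.
Proof. by rewrite frameE !mkvE; field. Qed.

Lemma olift_pos u s : olift (Some (pos u s)) = lift u s.
Proof. by rewrite /= xc_pos sc_pos. Qed.

Lemma lift_light u s : light_cone (lift u s).
Proof.
by apply/light_coneP; split; [exact: lift_null|left; rewrite ca_mkv].
Qed.

Definition point x : E9 := pos ((ca x)^-1 *: cu x) (cs x / ca x).

Lemma lift_point x : x ⋅ x = 0 -> ca x != 0 -> x = ca x *: olift (Some (point x)).
Proof.
move=> xx ax; rewrite olift_pos; apply: frame_ext; rewrite !clE !mkvE.
- by rewrite scalerA divff // scale1r.
- by field.
- by rewrite mulr1.
- rewrite !dotE; move: xx; rewrite frameE => xx.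
  have -> : eucl_dot (cu x) (cu x) = - cs x * cs x / 2 + ca x * cb x + cb x * ca x.
    by apply/eqP; rewrite -subr_eq0; apply/eqP; rewrite -[RHS]oppr0 -[in RHS]xx; field.
  by field.
Qed.

Lemma point_scale c x : c != 0 -> point (c *: x) = point x.
Proof.
move=> c0; rewrite /point !clE; congr pos; last by rewrite -mulf_div divff ?mul1r.
by rewrite scalerA invfM mulrAC mulVf ?mul1r.
Qed.

Lemma point_lift p : point (lift (xc p) (sc p)) = p.
Proof. by rewrite /point !mkvE invr1 scale1r mulr1 posK. Qed.

(** Any representative will do, because [point] is invariant under scaling. *)
Definition chart (r : set V) : E9 := point (xget 0 [set x | light_cone x /\ r = ray x]).

Lemma chart_ray x : light_cone x -> chart (ray x) = point x.
Proof.
move=> lx; rewrite /chart; case: xgetP => [y _ [ly e]|/(_ x)]; last by case.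
have : ray x x by exists 1; rewrite /= ?scale1r.
rewrite e => -[c /= c0 <-]; rewrite point_scale //; exact: lt0r_neq0.
Qed.

Lemma boundary_atP x : light_cone x -> boundary_at delta (ray x) -> 0 < ca x.
Proof.
move=> lx [_ nd]; have /light_coneP[_ [//|[c c0 xd]]] := lx.
case: nd; rewrite /= xd; apply/seteqP; split=> _ [k /= k0 <-].
  by exists (k * c); rewrite /= ?mulr_gt0 ?scalerA.
by exists (k / c); rewrite /= ?divr_gt0 // scalerA divfK // gt_eqF.
Qed.

Lemma boundary_at_lift u s : boundary_at delta (ray (lift u s)).
Proof.
split; first by exists (lift u s) => //; exact: lift_light.
move=> /= e; have : ray (lift u s) (lift u s) by exists 1; rewrite /= ?scale1r.
rewrite e => -[c c0 /(congr1 (@ca R))]; rewrite caZ !mkvE mulr0 => /eqP.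
by rewrite eq_sym oner_eq0.
Qed.

Lemma lift_lift u s u' s' :
  lift u s ⋅ lift u' s' = (eucl_dot (u - u') (u - u') + (s - s') ^+ 2 / 2) / 2.
Proof. by rewrite frameE !mkvE !dotE (dotC u' u); field. Qed.

Lemma chart_boundary_chart : boundary_chart delta chart.
Proof.
split=> [A B bA bB lA lB|].
  have aA := boundary_atP lA bA; have aB := boundary_atP lB bB.
  rewrite !chart_ray // !bform_delta dist_pos.
  have /light_coneP[AA _] := lA; have /light_coneP[BB _] := lB.
  have AB : A ⋅ B = ca A * ca B * (olift (Some (point A)) ⋅ olift (Some (point B))).
    rewrite {1}(lift_point AA (lt0r_neq0 aA)) {1}(lift_point BB (lt0r_neq0 aB)).
    by rewrite bformZl bformZr mulrA.
  by rewrite AB !olift_pos lift_lift; field; rewrite !lt0r_neq0.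
apply/seteqP; split=> // p _; exists (ray (lift (xc p) (sc p))).
  exact: boundary_at_lift.
by rewrite chart_ray ?point_lift //; exact: lift_light.
Qed.

(** The point [None] belongs to it exactly when n is orthogonal to [delta], that is, for
    hyperplanes. *)
Definition sphere_of n : set (option E9) := [set q | n ⋅ olift q = 0].

Lemma chart_boundary_sphere n :
  chart @` boundary_sphere n delta = [set p | sphere_of n (Some p)].
Proof.
apply/seteqP; split=> [_ [r [bx [x [lx e nx]]] <-]|p np]; last first.
  exists (ray (lift (xc p) (sc p))).
    split; first exact: boundary_at_lift.
    by exists (lift (xc p) (sc p)); split=> //; exact: lift_light.
  by rewrite chart_ray ?point_lift //; exact: lift_light.
have ax : 0 < ca x by apply: boundary_atP => //; rewrite -e.
rewrite e chart_ray //; have /light_coneP[xx _] := lx.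
move: nx; rewrite {1}(lift_point xx (lt0r_neq0 ax)) bformZr => /eqP.
by rewrite mulf_eq0 gt_eqF // => /eqP.
Qed.

(* g acts on R^9 with infinity as T does on rays. *)
Definition compat (g : option E9 -> option E9) (T : V -> V) : Prop :=
  forall q, exists2 c, c != 0 & olift (g q) = c *: T (olift q).

Definition isometric (T : V -> V) : Prop := forall x y, T x ⋅ T y = x ⋅ y.

Lemma olift_inj c q q' : olift q = c *: olift q' -> q = q'.
Proof.
case: q q' => [p|] [p'|] //= /[dup] /(congr1 (@ca R)).
- rewrite caZ !mkvE mulr1 => <- /[dup]/(congr1 (@cu R)) + /(congr1 (@cs R)).
  by rewrite cuZ csZ !mkvE scale1r mul1r => ex es; rewrite -[p]posK -[p']posK ex es.
- by rewrite caZ !mkvE mulr0 => /eqP; rewrite oner_eq0.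
- rewrite caZ !mkvE mulr1 => <- /(congr1 (@cb R)).
  by rewrite cbZ !mkvE mul0r => /eqP; rewrite oner_eq0.
Qed.

Lemma compat_cancel g h T T' : compat g T -> compat h T' ->
  (forall c x, T (c *: x) = c *: T x) -> (forall x, T (T' x) = x) -> cancel h g.
Proof.
move=> cg ch TZ TT' q; have [c c0 e] := cg (h q); have [d d0 f] := ch q.
by apply: (@olift_inj (c * d)); rewrite e f TZ TT' scalerA.
Qed.

Lemma compat_image g h T n : compat g T -> isometric T -> cancel h g ->
  g @` sphere_of n = sphere_of (T n).
Proof.
move=> cg iT hg.
have gS q : sphere_of (T n) (g q) <-> sphere_of n q.
  rewrite /sphere_of /=; have [c c0 ->] := cg q; rewrite bformZr iT.
  by split=> [/eqP|->]; rewrite ?mulr0 // mulf_eq0 (negPf c0) => /eqP.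
apply/seteqP; split=> [_ [q nq <-]|q nq]; first exact/gS.
by exists (h q) => //; apply/gS; rewrite hg.
Qed.

Definition maps_packing (g : option E9 -> option E9) : Prop :=
  forall n, P n -> exists2 n', P n' & g @` sphere_of n = sphere_of n'.

(** An inverse is carried along because [generated] is also closed under inverses. *)
Definition permutes_packing (g : option E9 -> option E9) : Prop :=
  maps_packing g /\ exists h, [/\ cancel g h, cancel h g & maps_packing h].

Lemma compat_permutes g h T T' : compat g T -> compat h T' ->
  isometric T -> isometric T' ->
  (forall c x, T (c *: x) = c *: T x) -> (forall c x, T' (c *: x) = c *: T' x) ->
  (forall x, T (T' x) = x) -> (forall x, T' (T x) = x) ->
  (forall n, P n -> P (T n)) -> (forall n, P n -> P (T' n)) ->
  permutes_packing g.
Proof.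
move=> cg ch iT iT' TZ TZ' TT' TT PT PT'.
have hg := compat_cancel cg ch TZ TT'; have gh := compat_cancel ch cg TZ' TT.
split=> [n Pn|]; first by exists (T n); [exact: PT|exact: compat_image hg].
exists h; split=> // n Pn.
by exists (T' n); [exact: PT'|exact: compat_image gh].
Qed.

Lemma reflZ i c x : refl i (c *: x) = c *: refl i x.
Proof. exact: (@actZ _ [:: i]). Qed.

Lemma refl_packing i n : P n -> P (refl i n).
Proof. by move=> /packingP[w ->]; apply/packingP; exists (i :: w). Qed.

Lemma compat_refl_permutes g i : compat g (refl i) -> permutes_packing g.
Proof.
move=> cg; apply: (compat_permutes cg cg); try exact: refl_bform; try exact: reflZ;
  try exact: reflK; exact: refl_packing.
Qed.

Lemma compat_refl_image g i n : compat g (refl i) ->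
  g @` sphere_of n = sphere_of (refl i n).
Proof.
move=> cg; apply: (compat_image _ cg); first exact: refl_bform.
by apply: (compat_cancel cg cg); [exact: reflZ|exact: reflK].
Qed.

Lemma permutes_generated (S : set (option E9 -> option E9)) g :
  (forall f, S f -> permutes_packing f) -> generated S g -> permutes_packing g.
Proof.
move=> hS; elim=> {g} [|g Sg|g h _ [mg [g' [gg' g'g mg']]] _ [mh [h' [hh' h'h mh']]]
  |g h _ [mg [g' [gg' g'g mg']]] gh hg].
- have mid : maps_packing id by move=> n Pn; exists n; rewrite // image_id.
  by split=> //; exists id.
- exact: hS.
- have comp a c : maps_packing a -> maps_packing c -> maps_packing (a \o c).
    move=> ma mc n Pn; have [n1 P1 e1] := mc n Pn; have [n2 P2 e2] := ma n1 P1.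
    by exists n2; rewrite // -image_comp e1 e2.
  split; first exact: comp.
  exists (h' \o g'); split; [| |exact: comp] => q /=.
    by rewrite gg' hh'.
  by rewrite h'h g'g.
- have -> : h = g' by apply/funext => q; rewrite -{2}[q]hg gg'.
  by split=> //; exists g; split.
Qed.

(** In the frame b_9 is (0, 0, 1, -1). On a lifted point the swap exchanges 1 with half the squared
    distance to [v], which is inversion with squared radius 2. *)
Lemma refl9E x : refl (inord 9) x = mkv (cu x) (cs x) (cb x) (ca x).
Proof.
apply: crdP => k lk; rewrite /refl crdD crdZ wallE // bvec_crd // inordK //=.
rewrite -[in LHS](mkvK x) /mkv !crd_mkrow //=.
by do 11 (case: k lk => [|k] lk /=; first by field).
Qed.

(** With [ca = 1] the height s becomes -s - 2, the reflection in s = -1, which is H. *)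
Lemma refl10E x : refl (inord 10) x = mkv (cu x) (- cs x - 2 * ca x) (ca x) (cb x + cs x + ca x).
Proof.
apply: crdP => k lk; rewrite /refl crdD crdZ wallE // bvec_crd // inordK //=.
rewrite -[in LHS](mkvK x) /mkv !crd_mkrow //=.
by do 11 (case: k lk => [|k] lk /=; first by field).
Qed.

Lemma compat_inversion r : r ^+ 2 = 2 -> compat (inversion v r) (refl (inord 9)).
Proof.
move=> r2 [p|]; last first.
  exists 1; rewrite ?oner_eq0 // scale1r refl9E /=.
  by rewrite /xc /sc subrr mul0mx dot0l mulr0 /lift dot0l expr0n /= !mul0r addr0 mul0r !mkvE.
rewrite -[p]posK; move: (xc p) (sc p) => u s {p}; rewrite olift_pos /=.
case: eqP => [e|ne].
  have u0 : u = 0 by rewrite -(xc_pos u s) e /xc subrr mul0mx.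
  have s0 : s = 0 by rewrite -(sc_pos u s) e /sc subrr dot0l mulr0.
  exists 1; rewrite ?oner_eq0 // scale1r refl9E !mkvE u0 s0.
  by rewrite /= dot0l expr0n /= !mul0r addr0 mul0r /delta.
have D : eucl_dist (pos u s) v ^+ 2 = eucl_dot u u + s ^+ 2 / 2.
  have -> : v = pos 0 0 by rewrite /pos mul0mx scale0r !addr0.
  by rewrite dist_pos !subr0.
set d := eucl_dot u u + s ^+ 2 / 2 in D *.
have d0 : d != 0.
  rewrite -D expf_eq0 /=; apply/eqP => d0; apply: ne; apply/eqP.
  rewrite -subr_eq0; apply/eqP/dot_eq0.
  by rewrite -eucl_dist_sqr d0 expr0n.
(* The swapped vector has [ca] equal to d / 2; this factor restores 1. *)
exists (2 / d); first by rewrite mulf_neq0 ?invr_neq0 ?pnatr_eq0.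
rewrite D r2 pos_sub.
have -> : v + (2 / d) *: (u *m M + s *: v) = pos ((2 / d) *: u) (2 / d * s).
  by rewrite /pos scalerDr scalerA addrA scalemxAl.
rewrite olift_pos refl9E !mkvE /lift -/d; apply: frame_ext; rewrite !clE !mkvE //.
  by field.
rewrite !dotE mulr1.
have -> : eucl_dot u u = d - s ^+ 2 / 2 by rewrite /d addrK.
by field.
Qed.

Lemma H_frame (h : E9) : h \in H -> h = (h *m M^T) *m M.
Proof.
move=> hH; by rewrite {1}[h]frame_complete (vH hH) mulr0 scale0r addr0.
Qed.

Lemma orthogonal_scale s : orthogonal_to H (s *: v).
Proof. by move=> h /vH hv; rewrite dotZr hv mulr0. Qed.

Lemma orthogonal_line (w : E9) : orthogonal_to H w -> w = (2 * eucl_dot w v) *: v.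
Proof.
move=> hw; rewrite {1}[w]frame_complete; have -> : w *m M^T = 0.
  apply: dot_eq0; have := hw _ (MH (w *m M^T)).
  by rewrite dotC /eucl_dot trmx_mul mulmxA => ->.
by rewrite mul0mx add0r.
Qed.

Lemma pos_split u s : pos u s = u *m M + (1 + s) *: v.
Proof. by rewrite /pos; apply/rowP => k; rewrite !mxE; ring. Qed.

Lemma compat_reflection g : reflection_in H g -> compat (omap g) (refl (inord 10)).
Proof.
move=> hg [p|] /=; exists 1; rewrite ?oner_eq0 // scale1r refl10E; last first.
  by rewrite !mkvE /delta oppr0 mulr0 subr0 !addr0.
rewrite -[p]posK; set u := xc p; set s := sc p.
rewrite [in g _]pos_split hg ?MH //; last exact: orthogonal_scale.
have -> : u *m M - (1 + s) *: v = pos u (- s - 2).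
  by rewrite pos_split; apply/rowP => k; rewrite !mxE; ring.
rewrite !xc_pos !sc_pos; apply: frame_ext; rewrite !mkvE //; first by rewrite mulr1.
by field.
Qed.

Lemma reflection_ex : exists2 g, reflection_in H g & compat (omap g) (refl (inord 10)).
Proof.
have hg : reflection_in H (fun p => pos (xc p) (- sc p - 2)).
  move=> h w hH /orthogonal_line ew; set s := 2 * _ in ew; rewrite (H_frame hH).
  set u := h *m M^T; have e : u *m M + w = pos u (s - 1).
    by rewrite pos_split ew; congr (_ + _ *: _); ring.
  rewrite e xc_pos sc_pos pos_split ew -scaleNr; congr (_ + _ *: _); ring.
by exists (fun p => pos (xc p) (- sc p - 2)); [|exact: compat_reflection].
Qed.

Definition lattice9 : set E9 := [set u *m M | u in E8].

(* An isometry of H is affine, since it preserves inner products of differences. *)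
Lemma lattice_symmetryP g : lattice_symmetry H lattice9 g ->
  exists Q t, [/\ Q *m Q^T = 1%:M,
    forall u s, g (pos u s) = pos (u *m Q + t) s,
    E8 t,
    forall u, E8 u -> E8 (u *m Q) & forall u, E8 u -> E8 (u *m Q^T)].
Proof.
move=> [f [fH fd fL fg]].
pose F u : 'rV[R]_8 := f (u *m M) *m M^T.
have FM u : f (u *m M) = F u *m M by apply: H_frame; apply: fH; apply: MH.
have Fd u u' : eucl_dot (F u - F u') (F u - F u') = eucl_dot (u - u') (u - u').
  have := congr1 (fun c => c ^+ 2) (fd _ _ (MH u) (MH u')).
  by rewrite !eucl_dist_sqr !FM -!mulmxBl !dot_M.
have F8 u : E8 u -> E8 (F u).
  move=> hu; have : lattice9 (f (u *m M)) by rewrite -fL; exists (u *m M) => //; exists u.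
  by case=> u' hu' e; rewrite /F -e -mulmxA MM mulmx1.
have F8s u : E8 u -> exists2 u', E8 u' & F u' = u.
  move=> hu; have : lattice9 (u *m M) by exists u.
  rewrite -fL => -[_ [u' hu' <-] e]; exists u' => //.
  by rewrite /F e -mulmxA MM mulmx1.
pose t := F 0; pose G u := F u - t.
have Gd u u' : eucl_dot (G u) (G u') = eucl_dot u u'.
  apply: dot_polarize; [|by rewrite Fd subr0|by rewrite Fd subr0].
  by rewrite -[RHS]Fd /G opprB addrA subrK.
(* [G] preserves inner products, so pairing [G u] with the rows of Q returns the coordinates of u;
   this makes [G] linear. *)
pose Q : 'M[R]_8 := \matrix_i G (delta_mx 0 i).
have rowQ k : row k Q = G (delta_mx 0 k) by rewrite rowK.
have dotrow (A : 'rV[R]_8) k : (A *m Q^T) 0 k = eucl_dot A (row k Q).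
  by rewrite /eucl_dot !mxE; apply: eq_bigr => l _; rewrite !mxE.
have GQt u : G u *m Q^T = u.
  by apply/rowP => k; rewrite dotrow rowQ Gd /eucl_dot trmx_delta -colE mxE.
have QQ : Q *m Q^T = 1%:M.
  by apply/row_matrixP => k; rewrite row_mul rowQ GQt row1.
have QQ' : Q^T *m Q = 1%:M by apply: mulmx1C.
have GQ u : G u = u *m Q by rewrite -{2}[u]GQt -mulmxA QQ' mulmx1.
have Et : E8 t by apply: F8; exact: E8_0.
exists Q, t; split=> //.
- move=> u s; rewrite pos_split fg ?MH //; last exact: orthogonal_scale.
  by rewrite FM -GQ /G subrK pos_split.
- by move=> u hu; rewrite -GQ; apply: E8B => //; apply: F8.
(* Surjectivity of the symmetry on the lattice yields invariance under the inverse matrix. *)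
- move=> u hu; have : E8 (u + 1 *: t) by apply: E8_lincomb; rewrite ?rpred1.
  rewrite scale1r => /F8s[u' hu' e].
  have -> : u = u' *m Q by rewrite -GQ /G e addrK.
  by rewrite -mulmxA QQ mulmx1.
Qed.

Lemma compat_motion g Q t : Q *m Q^T = 1%:M ->
  (forall u s, g (pos u s) = pos (u *m Q + t) s) -> compat (omap g) (motion Q t).
Proof.
move=> QQ hg [p|] /=; exists 1; rewrite ?oner_eq0 // scale1r; last first.
  by rewrite motion_fix // /delta mkvE.
rewrite -[p]posK hg !xc_pos !sc_pos /motion !mkvE; apply: frame_ext; rewrite !mkvE //.
  by rewrite scale1r.
by rewrite !dotE (dot_orthogonal QQ) (dotC t); field.
Qed.

Lemma lattice_symmetry_permutes g :
  lattice_symmetry H lattice9 g -> permutes_packing (omap g).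
Proof.
move=> /lattice_symmetryP[Q [t [QQ hg Et EQ EQ']]].
have QQ' : Q^T *m Q = 1%:M by apply: mulmx1C.
have QQ'' : Q^T *m Q^T^T = 1%:M by rewrite trmxK.
pose t' := - t *m Q^T; pose h p := pos (xc p *m Q^T + t') (sc p).
have hh u s : h (pos u s) = pos (u *m Q^T + t') s by rewrite /h xc_pos sc_pos.
have Et' : E8 t' by apply: EQ'; rewrite -[- t]sub0r; apply: E8B => //; exact: E8_0.
have Z (A : 'M[R]_8) r c x : motion A r (c *: x) = c *: motion A r x.
  have := @motion_linear _ A r c 0 x; rewrite !add0r => ->.
  by rewrite motion_fix ?add0r // -(scale0r (0 : V)) clE ?scale0r ?mul0r.
have t'Q : t' *m Q = - t by rewrite /t' -mulmxA QQ' mulmx1.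
have tQ : t *m Q^T = - t' by rewrite /t' mulNmx opprK.
have dtt : eucl_dot t' t' = eucl_dot t t.
  by rewrite -(dot_orthogonal QQ) t'Q !dotE; ring.
apply: (@compat_permutes _ (omap h) (motion Q t) (motion Q^T t')) => //.
- exact: compat_motion.
- exact: compat_motion.
- exact: motion_bform.
- exact: motion_bform.
- move=> x; apply: frame_ext; rewrite !mkvE //.
    by rewrite mulmxDl -mulmxA QQ' mulmx1 -scalemxAl t'Q scalerN addrNK.
  rewrite mulmxDl -mulmxA QQ' mulmx1 -scalemxAl t'Q !dotE dtt.
  have -> : eucl_dot (cu x *m Q^T) t' = - eucl_dot (cu x) t.
    by rewrite -(dot_orthogonal QQ) t'Q -mulmxA QQ' mulmx1 dotNr.
  by field.
- move=> x; apply: frame_ext; rewrite !mkvE //.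
    by rewrite mulmxDl -mulmxA QQ mulmx1 -scalemxAl tQ scalerN addrNK.
  rewrite mulmxDl -mulmxA QQ mulmx1 -scalemxAl tQ !dotE dtt.
  have -> : eucl_dot (cu x *m Q) t = - eucl_dot (cu x) t'.
    by rewrite -[t in eucl_dot _ t]opprK -t'Q dotNr (dot_orthogonal QQ).
  by field.
- by move=> n; apply: motion_packing.
- by move=> n; apply: motion_packing.
Qed.

(** With a = [cu (b i)] and the integer m = [cb (b i)], the reflection acts on R^8 as the affine
    reflection in the hyperplane where the product with a is m; m is 1 for b_8 and 0 for the
    others. *)
Lemma lattice_symmetry_refl i : (i < 9)%N ->
  exists2 g, lattice_symmetry H lattice9 g & compat (omap g) (refl i).
Proof.
move=> i9; set a := cu (b i); set m := cb (b i).
have ca0 : ca (b i) = 0 by rewrite ca_bvec // ltn_eqF.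
have cs0 : cs (b i) = 0 by rewrite /cs bvec_crd // (gtn_eqF (leqW i9)) mulr0.
have aa : eucl_dot a a = 2.
  by have := bform_bvec_self R i; rewrite frameE ca0 cs0 -/a; lra.
have Ea : E8 a by apply: cu_E8; exact: integral_bvec.
have im : m \is a Num.int by rewrite /m /cb !(rpredD, rpredN) //; exact: integral_bvec.
pose F u := u + (m - eucl_dot a u) *: a.
have FK u : F (F u) = u.
  by rewrite /F !dotE aa; apply/rowP => k; rewrite !mxE; ring.
have Fd u u' : eucl_dot (F u - F u') (F u - F u') = eucl_dot (u - u') (u - u').
  have -> : F u - F u' = (u - u') + (eucl_dot a u' - eucl_dot a u) *: a.
    by rewrite /F; apply/rowP => k; rewrite !mxE; ring.
  by rewrite !dotE aa (dotC u a) (dotC u' a); ring.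
have F8 u : E8 u -> E8 (F u).
  by move=> hu; apply: E8_lincomb => //; rewrite rpredB // E8_dot.
pose g p := pos (F (xc p)) (sc p).
exists g.
  exists (fun h => F (h *m M^T) *m M); split.
  - by move=> h _; apply: MH.
  - move=> h h' hH hH'; apply/eqP; rewrite -(eqrXn2 (n := 2)) ?eucl_dist_ge0 //.
    rewrite !eucl_dist_sqr -mulmxBl dot_M Fd -mulmxBl -dot_M.
    by rewrite -(H_frame (memvB hH hH')).
  - apply/seteqP; split=> [_ [_ [u hu <-] <-]|_ [u hu <-]].
      by exists (F u); [exact: F8|rewrite -mulmxA MM mulmx1].
    exists (F u *m M); first by exists (F u) => //; exact: F8.
    by rewrite -mulmxA MM mulmx1 FK.
  - move=> h w hH /orthogonal_line ew; set s := 2 * _ in ew.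
    set u := h *m M^T; have e : h + w = pos u (s - 1).
      by rewrite (H_frame hH) -/u pos_split ew; congr (_ + _ *: _); ring.
    rewrite e /g xc_pos sc_pos pos_split ew; congr (_ + _ *: _); ring.
case=> [p|] /=; exists 1; rewrite ?oner_eq0 // scale1r.
  rewrite xc_pos sc_pos /refl; set x := lift (xc p) (sc p).
  have bx : b i ⋅ x = m - eucl_dot a (xc p).
    by rewrite frameE ca0 cs0 -/a -/m !mkvE; ring.
  rewrite bx; apply: frame_ext; rewrite !clE ?ca0 ?cs0 -/a -/m !mkvE ?mulr0 ?addr0 //.
  by rewrite /F !dotE aa (dotC (xc p) a); field.
by rewrite /refl bform_delta ca0 scale0r addr0.
Qed.

(** * The initial spheres as members of the packing *)

Lemma mem_H u k : u *m M + k *: v \in H <-> k = 0.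
Proof.
split=> [/vH|->]; last by rewrite scale0r addr0 MH.
rewrite !dotE dot_Mv vv add0r => h; lra.
Qed.

Lemma parallelP c u s : parallel H (c *: v) (pos u s) <-> s = c - 1.
Proof.
rewrite /parallel /= pos_split; have -> : u *m M + (1 + s) *: v - c *: v =
    u *m M + (1 + s - c) *: v by apply/rowP => k; rewrite !mxE; ring.
by split=> [/mem_H h|->]; [lra|apply/mem_H; ring].
Qed.

Lemma bform_nu_cs x : nu ⋅ x = - cs x.
Proof. by rewrite bform_nu /cs; ring. Qed.

Lemma sphere_parallel n c : n ⋅ delta = 0 ->
  (forall u s, n ⋅ lift u s = 0 <-> s = c - 1) ->
  sphere_of n = Some @` parallel H (c *: v) `|` [set None].
Proof.
move=> nd nl; apply/seteqP; split=> [[p|] /=|_ [[p hp <-]|->]] //=.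
- by move=> /nl hp; left; exists p => //; rewrite -[p]posK; apply/parallelP.
- by right.
- by move: hp; rewrite -{1}[p]posK => /parallelP hs; apply/nl.
Qed.

Lemma sphere_nu : sphere_of nu = Some @` parallel H v `|` [set None].
Proof.
rewrite -{1}[v]scale1r; apply: sphere_parallel => [|u s].
  by rewrite bform_nu_cs /delta mkvE oppr0.
by rewrite bform_nu_cs mkvE; split=> h; lra.
Qed.

Lemma sphere_nu' : sphere_of (refl (inord 10) nu) = Some @` parallel H (- v) `|` [set None].
Proof.
have e x : refl (inord 10) nu ⋅ x = nu ⋅ refl (inord 10) x.
  exact: (@act_adj _ [:: inord 10]).
rewrite -scaleN1r; apply: sphere_parallel => [|u s]; rewrite e bform_nu_cs refl10E !mkvE.
  by ring.
by split=> h; lra.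
Qed.

(* The sphere of radius 1/sqrt 2 centred at c. *)
Definition ball_root c : V := mkv (2 *: c) (-2) 2 (eucl_dot c c).

Lemma nu_frame : nu = mkv 0 2 0 0.
Proof.
apply: frame_ext; rewrite !mkvE ?cu_nu //; rewrite /cs /ca /cb nuE !crd_mkrow //=; by ring.
Qed.

Lemma b9_frame : b (inord 9) = mkv 0 0 1 (-1).
Proof.
apply: frame_ext; rewrite !mkvE; last 3 first.
- by rewrite /cs bvec_crd // inordK //= mulr0.
- by rewrite /ca bvec_crd // inordK.
- by rewrite /cb !bvec_crd // inordK //=; ring.
apply: crdP => k lk; rewrite crd0 /cu crd_mkrow // !bvec_crd // inordK //=.
by do 8 (case: k lk => [|k] lk /=; first by field).
Qed.

(** Here y is the hyperplane through B, and sigma sends it to y + 2 b_9, the ball at the origin.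
    Affine reflections fix y, so an affine word taking b_9 to the root m takes this ball to y + 2 m,
    the ball at c. *)
Lemma ball_root_packing c : E8 c -> P (ball_root c).
Proof.
move=> hc; pose y : V := refl (inord 10) nu.
have yE : y = mkv 0 (-2) 0 2.
  by rewrite /y nu_frame refl10E !mkvE; congr mkv; ring.
pose m : V := mkv c 0 1 ((eucl_dot c c - 2) / 2).
have yfix i : (i < 9)%N -> b i ⋅ y = 0.
  move=> i9; rewrite frameE yE !mkvE ca_bvec ?ltn_eqF // dot0r.
  by rewrite /cs bvec_crd // (gtn_eqF (leqW i9)) /=; field.
have mm : m ⋅ m = -2 by rewrite frameE !mkvE; field.
have [w aw e] : exists2 w, affine_word w & act w m = b (inord 9).
  apply: level1_orbit => //.
  - apply: mkv_integral; rewrite ?mul0r ?rpred0 ?rpred1 //.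
    have -> : (eucl_dot c c - 2) / 2 = eucl_dot c c / 2 - 1 by field.
    by apply: rpredB; [exact: E8_norm|exact: rpred1].
  - by rewrite -/(ca _) mkvE.
  - by rewrite /m /mkv crd_mkrow //= oppr0 mul0r.
have y9 : refl (inord 9) y = y + 2 *: b (inord 9).
  by rewrite b9_frame refl9E yE; apply: frame_ext; rewrite ?clE !mkvE ?scaler0 ?addr0 //; ring.
have -> : ball_root c = act (rev w) (refl (inord 9) y).
  rewrite y9 actD actZ -e actK (affine_word_fix (affine_word_rev aw) yfix) yE.
  by apply: frame_ext; rewrite ?clE !mkvE ?add0r //; field.
apply/packingP; exists (rev w ++ [:: inord 9; inord 10]).
by rewrite act_cat.
Qed.

Lemma sphere_ball c r : 0 <= r -> r ^+ 2 = 1 / 2 ->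
  sphere_of (ball_root c) = Some @` eucl_sphere (c *m M) r.
Proof.
move=> r0 r2.
have cM : c *m M = pos c (-1).
  by rewrite /pos; apply/rowP => k; rewrite !mxE; ring.
have key u s : ball_root c ⋅ lift u s = 0 <-> eucl_dist (pos u s) (c *m M) = r.
  have -> : ball_root c ⋅ lift u s = eucl_dist (pos u s) (c *m M) ^+ 2 - r ^+ 2.
    by rewrite cM dist_pos r2 frameE !mkvE !dotE (dotC c u); field.
  split=> [/eqP|->]; last by rewrite subrr.
  by rewrite subr_eq0 eqrXn2 ?eucl_dist_ge0 // => /eqP.
apply/seteqP; split=> [[p|] /=|_ [p hp <-]] /=.
- by move=> /key; rewrite posK => h; exists p.
- by rewrite /sphere_of /= bform_delta mkvE => /eqP; rewrite pnatr_eq0.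
- by apply/key; rewrite posK.
Qed.

(** * The image group and the orbit of nu *)

Section Group.
Variables (r r0 : R).
Hypotheses (r2 : r ^+ 2 = 2) (r0_ge0 : 0 <= r0) (r02 : r0 ^+ 2 = 1 / 2).
Local Notation gens := (generators H lattice9 (inversion v r)).

Lemma generators_permute g : gens g -> permutes_packing g.
Proof.
case=> [[->|[f fL <-]]|[f fH <-]].
- by apply: compat_refl_permutes; exact: compat_inversion.
- exact: lattice_symmetry_permutes.
- by apply: compat_refl_permutes; exact: compat_reflection.
Qed.

Lemma generators_refl i : exists2 g, gens g & compat g (refl i).
Proof.
have [i9|i9|i9] := ltngtP (i : nat) 9%N.
- by have [g gL cg] := lattice_symmetry_refl i9; exists (omap g) => //; left; right; exists g.
- have -> : i = inord 10.
    by apply/val_inj; rewrite /= inordK //; apply/eqP; rewrite eqn_leq -ltnS ltn_ord.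
  by have [g gH cg] := reflection_ex; exists (omap g) => //; right; exists g.
- have -> : i = inord 9 by apply/val_inj; rewrite /= inordK.
  by exists (inversion v r); [left; left|exact: compat_inversion].
Qed.

Lemma initial_packing X : initial_spheres H lattice9 r0 v X ->
  exists2 n, P n & X = sphere_of n.
Proof.
case=> [[_ [c hc <-] <-]|[->|->]].
- by exists (ball_root c); [exact: ball_root_packing|rewrite (sphere_ball c r0_ge0 r02)].
- by exists nu; [apply/packingP; exists [::]|rewrite sphere_nu].
- by exists (refl (inord 10) nu); [apply/packingP; exists [:: inord 10]|rewrite sphere_nu'].
Qed.

Lemma perspective_of_packing :
  is_perspective P (image_spheres (generated gens) (initial_spheres H lattice9 r0 v)).
Proof.
exists delta; first exact: light_delta.
exists chart; first exact: chart_boundary_chart.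
apply/seteqP; split=> [Y [g [X [Gg /initial_packing[n Pn ->] ->]]]|_ [n Pn <-]].
  have [/(_ n Pn)[n' Pn' e] _] := permutes_generated generators_permute Gg.
  by exists n' => //; rewrite chart_boundary_sphere e.
(* Induction on the word: each of its simple reflections is realised by one generator. *)
have [g Gg e] : exists2 g, generated gens g & g @` sphere_of nu = sphere_of n.
  have /packingP[w ->] := Pn; elim: w => [|i w [g Gg e]].
    by exists id; [exact: generated_id|rewrite image_id].
  have [f Gf cf] := generators_refl i; exists (f \o g).
    by apply: generated_comp => //; exact: generated_in.
  by rewrite -image_comp e (compat_refl_image _ cf).
exists g, (sphere_of nu); split=> //; last by rewrite chart_boundary_sphere e.
by right; left; rewrite sphere_nu.
Qed.

End Group.

End Perspective.

Lemma linear_isometry_mulmx (R : realType) (J : 'rV[R]_8 -> 'rV[R]_9) :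
  linear_isometry J -> exists2 M : 'M[R]_(8, 9), M *m M^T = 1%:M & J = mulmx^~ M.
Proof.
move=> [Jl Jd].
pose M : 'M[R]_(8, 9) := lin1_mx (HB.pack J (GRing.isLinear.Build R _ _ _ J Jl) : {linear _ -> _}).
have JM u : J u = u *m M by rewrite mul_rV_lin1.
exists M; last by apply/funext => u; rewrite JM.
have dM (u w : 'rV[R]_8) : eucl_dot (u *m M) (w *m M) = eucl_dot u w.
  by apply: dot_polarize; [rewrite -mulmxBl -JM Jd|rewrite -JM Jd|rewrite -JM Jd].
apply/row_matrixP => k; rewrite row_mul row1 rowE; apply/rowP => l.
transitivity (eucl_dot (delta_mx 0 k *m M) (delta_mx 0 l *m M)).
  by rewrite /eucl_dot trmx_mul mulmxA trmx_delta -colE [RHS]mxE.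
by rewrite dM /eucl_dot trmx_delta -colE [LHS]mxE.
Qed.

Theorem mainTheorem6 (R : realType) :
  (forall (H : {vspace 'rV[R]_9}) (J : 'rV[R]_8 -> 'rV[R]_9) (v A B : 'rV[R]_9),
     \dim H = 8%N ->
     linear_isometry J ->
     (forall x, J x \in H) ->
     orthogonal_to H v ->
     eucl_dist v 0 = 1 / Num.sqrt 2 ->
     eucl_sphere 0 (1 / Num.sqrt 2) `&` parallel H v = [set A] ->
     eucl_sphere 0 (1 / Num.sqrt 2) `&` parallel H (- v) = [set B] ->
     let L := J @` @E8_lattice R in
     let sigma := inversion A (eucl_dist A B) in
     is_perspective (@T238_packing R)
       (image_spheres (generated (generators H L sigma))
          (initial_spheres H L (1 / Num.sqrt 2) v))) /\
  apollonian_packing (@T238_packing R).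
Proof.
split; last exact: T238_apollonian.
move=> H J v A B _ /linear_isometry_mulmx[M MM ->] MH vH vr hA hB L sigma.
have r2 : (1 / Num.sqrt 2) ^+ 2 = 1 / 2 :> R by rewrite expr_div_n expr1n sqr_sqrtr.
have vv : eucl_dot v v = 1 / 2 by rewrite -r2 -vr eucl_dist_sqr subr0.
rewrite {}/sigma {}/L.
(* The tangency points are v and -v, since each lies in the corresponding singleton intersection. *)
have <- : v = A.
  have : [set A] v; last by [].
  by rewrite -hA; split=> //; rewrite /parallel /= subrr mem0v.
have <- : - v = B.
  have : [set B] (- v); last by [].
  rewrite -hB; split; last by rewrite /parallel /= subrr mem0v.
  by rewrite /eucl_sphere /= -vr /eucl_dist !subr0 dotNl dotNr opprK.
apply: perspective_of_packing => //; last by rewrite divr_ge0 ?sqrtr_ge0.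
(* The radius of sigma is twice the length of v, so its square is 2. *)
rewrite eucl_dist_sqr opprK !dotE vv; lra.
Qed.
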